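(* For every universal semi-POVM $M$ there exists a sequence $F_0,F_1,F_2,\dots$ of semi-POVMs on $\Sigma^*$ such that: (i) $F_n(s)\in\mathrm{Her}_Q(N)$ and $0<F_n(s)\leqslant F_{n+1}(s)\leqslant M(s)$ for all $(n,s)\in\mathbb{N}\times\Sigma^*$ (where $0<A$ means $A$ is positive definite); (ii) $F_n\to M$ uniformly, i.e. $\sup_{s\in\Sigma^*}\|F_n(s)-M(s)\|\to 0$ as $n\to\infty$; (iii) the map $\mathbb{N}\times\Sigma^*\ni(n,s)\mapsto F_n(s)$ is a total recursive function.
   Context: $N$ is a fixed positive integer; $\Sigma^*$ is the set of finite binary strings. $\mathrm{Her}(N)$ is the set of $N\times N$ Hermitian matrices and $\mathrm{Her}_Q(N)$ those with entries in $\{a+ib:a,b\in\mathbb{Q}\}$; $A\leqslant B$ means $B-A$ is positive semi-definite; $\|\cdot\|$ is the operator norm. A semi-POVM on $\Sigma^*$ is a map $R:\Sigma^*\to\mathrm{Her}(N)$ with $0\leqslant R(s)$ for all $s$ and $\sum_s R(s)\leqslant I$. A lower-computable semi-POVM is a semi-POVM $R$ for which there is a total recursive $f:\mathbb{N}\times\Sigma^*\to\mathrm{Her}_Q(N)$ with $\lim_{n}f(n,s)=R(s)$ and $f(n,s)\leqslant R(s)$ for all $n,s$. A universal semi-POVM is a lower-computable semi-POVM $M$ such that for every lower-computable semi-POVM $R$ there is $c>0$ with $c\,R(s)\leqslant M(s)$ for all $s\in\Sigma^*$. *)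

(* Defs.v *)
(* with MathComp-Analysis reals (for sup) and real_closed complex. *)
From HB Require Import structures.
From mathcomp Require Import all_boot all_order all_algebra.
From mathcomp Require Import classical_sets reals.
From mathcomp Require Import complex.
Set Implicit Arguments. Unset Strict Implicit. Unset Printing Implicit Defensive.
Import Order.TTheory GRing.Theory Num.Theory.
Local Open Scope ring_scope.

(* Computability: partial recursive (mu-recursive) functions on nat lists *)

Inductive recf : Type :=
| rZero : recf                         (* constant 0 *)
| rSucc : recf                         (* x :: _ |-> x + 1 *)
| rProj : nat -> recf                  (* i-th projection *)
| rComp : recf -> seq recf -> recf     (* g (h_1 v, ..., h_m v) *)
| rPrec : recf -> recf -> recf         (* primitive recursion on the first arg *)
| rMu   : recf -> recf.                (* unbounded minimisation on the first arg *)

Inductive reval : recf -> seq nat -> nat -> Prop :=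
| ev_zero v : reval rZero v 0
| ev_succ x v : reval rSucc (x :: v) x.+1
| ev_proj i v : (i < size v)%N -> reval (rProj i) v (nth 0%N v i)
| ev_comp g hs v ys y :
    revals hs v ys -> reval g ys y -> reval (rComp g hs) v y
| ev_prec0 g h v y : reval g v y -> reval (rPrec g h) (0%N :: v) y
| ev_precS g h n v y z :
    reval (rPrec g h) (n :: v) y -> reval h (n :: y :: v) z ->
    reval (rPrec g h) (n.+1 :: v) z
| ev_mu g v n :
    reval g (n :: v) 0 ->
    (forall m, (m < n)%N -> exists k, reval g (m :: v) k.+1) ->
    reval (rMu g) v n
with revals : seq recf -> seq nat -> seq nat -> Prop :=
| evs_nil v : revals [::] v [::]
| evs_cons h hs v y ys :
    reval h v y -> revals hs v ys -> revals (h :: hs) v (y :: ys).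

(* A total function between countable types is total recursive when some
   mu-recursive program maps the (canonical, computable) code of every input
   to the code of its output. *)
Definition total_recursive (A B : countType) (f : A -> B) : Prop :=
  exists p : recf, forall x : A, reval p [:: pickle x] (pickle (f x)).

(* Finite binary strings. *)
Definition bstring := seq bool.

(* Hermitian matrices, Loewner order, operator norm                        *)

Section Matrices.
Variable R : realType.
Local Notation C := (R[i]).
Variable N : nat.

Definition adj (m n : nat) (A : 'M[C]_(m, n)) : 'M[C]_(n, m) :=
  (map_mx (fun z : C => z^*) A)^T.

Definition hermitian (A : 'M[C]_N) : Prop := adj A = A.

(* positive semi-definite *)
Definition psd (A : 'M[C]_N) : Prop :=
  hermitian A /\ forall v : 'cV[C]_N, 0 <= (adj v *m A *m v) 0 0.

(* positive definite *)
Definition posdef (A : 'M[C]_N) : Prop :=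
  hermitian A /\ forall v : 'cV[C]_N, v != 0 -> 0 < (adj v *m A *m v) 0 0.

(* Loewner order  A <= B  iff  B - A is positive semi-definite *)
Definition loewner (A B : 'M[C]_N) : Prop := psd (B - A).

(* Euclidean norm of a vector *)
Definition vnorm (v : 'cV[C]_N) : R :=
  Num.sqrt (\sum_i ((complex.Re (v i 0)) ^+ 2 + (complex.Im (v i 0)) ^+ 2)).

(* operator norm *)
Definition opnorm (A : 'M[C]_N) : R :=
  sup [set vnorm (A *m v) | v in [set v : 'cV[C]_N | vnorm v <= 1]]%classic.

(* Her_Q(N): matrices with entries a+ib, a,b rational, given by the pair
   (real part, imaginary part) of rational matrices. *)
Definition QCmat := ('M[rat]_N * 'M[rat]_N)%type.

Definition embQ (X : QCmat) : 'M[C]_N :=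
  \matrix_(i, j) Complex (ratr (X.1 i j)) (ratr (X.2 i j)).

Definition in_HerQ (X : QCmat) : Prop := hermitian (embQ X).

(* semi-POVMs                                                             *)

(* R(s) >= 0 for all s, and sum_s R(s) <= I (the sum of a family of positive
   semi-definite matrices being <= I means every finite partial sum is <= I). *)
Definition semiPOVM (Rm : bstring -> 'M[C]_N) : Prop :=
  (forall s, psd (Rm s)) /\
  (forall l : seq bstring, uniq l -> loewner (\sum_(s <- l) Rm s) 1%:M).

Definition lower_computable (Rm : bstring -> 'M[C]_N) : Prop :=
  semiPOVM Rm /\
  exists f : nat * bstring -> QCmat,
    total_recursive f /\
    (forall n s, in_HerQ (f (n, s))) /\
    (forall s, forall eps : R, 0 < eps -> exists n0 : nat, forall n : nat,
        (n0 <= n)%N -> opnorm (embQ (f (n, s)) - Rm s) <= eps) /\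
    (forall n s, loewner (embQ (f (n, s))) (Rm s)).

Definition universal_semiPOVM (M : bstring -> 'M[C]_N) : Prop :=
  lower_computable M /\
  forall Rm : bstring -> 'M[C]_N, lower_computable Rm ->
    exists c : R, 0 < c /\ forall s, loewner ((c%:C)%C *: Rm s) (M s).

End Matrices.

(* Main.v *)
Require Import Defs.
From HB Require Import structures.
From mathcomp Require Import all_boot all_order all_algebra.
From mathcomp Require Import classical_sets reals boolp.
From mathcomp Require Import complex.
From mathcomp Require Import ring lra.
(* [hermitian] of Defs is shadowed by an abbreviation of all_algebra. *)
Import Order.TTheory GRing.Theory Num.Theory Defs.
Set Implicit Arguments. Unset Strict Implicit. Unset Printing Implicit Defensive.

(** Let [f] approximate [M] from below.  Universality against the scalar
    semi-POVM [s |-> 2^-(pickle s + 1) I] gives a rational [g s > 0] with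
    [g s I <= M s].  Put [H_0 = g I] and [H_(n+1) = f(m, s)], where [m > n] is
    found by unbounded search together with a rational matrix [B] such that
    [f(m, s) - H_n] and [B^* B] agree entrywise up to a small [eta_n].  Such a
    pair exists because [M s - H_n] is positive semi-definite, hence of the form
    [S^* S], and it certifies [H_n <= H_(n+1) + g 2^-(n+2) I].  So
    [F_n = H_n - g 2^-(n+1) I] is increasing, bounded by [M], positive definite
    because [F_0 = g/2 I] is, and converges to [M] pointwise; convergence is
    uniform because the traces of [M] are summable.

    For recursiveness, all codes in play are nested [CodeSeq] codes; since [N] is
    fixed, matrix operations are finite combinations of rational operations on
    entries, and these reduce to natural-number arithmetic through
    [x = (a - b) / d]. *)

(** * Recursive functions *)

(* Allowing an arbitrary domain type and argument vector covers functions of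
   several arguments and functions that are computed on a subdomain only. *)
Definition recursive_in (T : Type) (env : T -> seq nat) (B : countType)
    (f : T -> B) : Prop :=
  exists p : recf, forall x, reval p (env x) (pickle (f x)).

Definition recursive2 (g : nat -> nat -> nat) : Prop :=
  exists p : recf, forall a b, reval p [:: a; b] (g a b).

Section Combinators.
Variables (T : Type) (env : T -> seq nat).

Lemma eq_recursive_in (B : countType) (f g : T -> B) :
  f =1 g -> recursive_in env f -> recursive_in env g.
Proof. by move=> fg [p pP]; exists p => x; rewrite -fg. Qed.

(** Recursiveness sees only codes, so a function may be traded for one into another type with the
    same codes. This is how Booleans, pairs, integers, rationals and matrices are reduced to
    natural-number arithmetic. *)
Lemma recursive_in_code (A B : countType) (f : T -> A) (g : T -> B) :
  recursive_in env f -> (forall x, pickle (f x) = pickle (g x)) ->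
  recursive_in env g.
Proof. by move=> [p pP] fg; exists p => x; rewrite -fg. Qed.

Lemma recursive_in_comp (A B : countType) (g : A -> B) (f : T -> A) :
  total_recursive g -> recursive_in env f -> recursive_in env (fun x => g (f x)).
Proof.
move=> [p pP] [q qP]; exists (rComp p [:: q]) => x.
by apply: ev_comp (pP _); apply: evs_cons (qP _) (evs_nil _).
Qed.

Lemma recursive_in_comp2 g (f1 f2 : T -> nat) :
  recursive2 g -> recursive_in env f1 -> recursive_in env f2 ->
  recursive_in env (fun x => g (f1 x) (f2 x)).
Proof.
move=> [p pP] [q1 q1P] [q2 q2P]; exists (rComp p [:: q1; q2]) => x.
apply: ev_comp (pP _ _).
exact: evs_cons (q1P _) (evs_cons (q2P _) (evs_nil _)).
Qed.

Lemma recursive_in_proj i :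
  (forall x, i < size (env x)) -> recursive_in env (fun x => nth 0 (env x) i).
Proof. by move=> lt_i; exists (rProj i) => x; apply: ev_proj. Qed.

Lemma recursive_in_succ (f : T -> nat) :
  recursive_in env f -> recursive_in env (fun x => (f x).+1).
Proof.
move=> [p pP]; exists (rComp rSucc [:: p]) => x.
exact: ev_comp (evs_cons (pP _) (evs_nil _)) (ev_succ _ _).
Qed.

Lemma recursive_in_nat (n : nat) : recursive_in env (fun=> n).
Proof.
elim: n => [|n /recursive_in_succ//]; exists rZero => x; exact: ev_zero.
Qed.

Lemma recursive_in_const (B : countType) (b : B) : recursive_in env (fun=> b).
Proof. exact: recursive_in_nat (pickle b). Qed.

Lemma recursive_in_mu (P : nat * T -> nat) (g : T -> nat) :
  recursive_in (fun u : nat * T => u.1 :: env u.2) P ->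
  (forall x, P (g x, x) = 0) -> (forall x m, m < g x -> P (m, x) != 0) ->
  recursive_in env g.
Proof.
move=> [p pP] P0 Pn0; exists (rMu p) => x; apply: ev_mu.
  by have := pP (g x, x); rewrite P0.
by move=> m /Pn0; have := pP (m, x); case: (P _) => // k; exists k.
Qed.

End Combinators.

(** The step program need only be correct when its second argument codes the actual previous value.
    This matters for [approx], whose search is guaranteed to succeed only on such values. *)
Lemma recursive_in_prec (B : countType) (T : Type) (e : T -> nat)
    (h : nat -> T -> B) :
  recursive_in (fun x => [:: e x]) (h 0) ->
  recursive_in (fun u : nat * T => [:: u.1; pickle (h u.1 u.2); e u.2])
               (fun u => h u.1.+1 u.2) ->
  recursive_in (fun u : nat * T => [:: u.1; e u.2]) (fun u => h u.1 u.2).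
Proof.
move=> [p pP] [q qP]; exists (rPrec p q) => -[n x] /=.
elim: n => [|n IHn]; first exact: ev_prec0.
exact: ev_precS IHn (qP (n, x)).
Qed.

Lemma recursive2_prec (g : nat -> nat -> nat) :
  recursive_in (fun x : nat => [:: x]) (g 0) ->
  recursive_in (fun u : nat * nat => [:: u.1; g u.1 u.2; u.2])
               (fun u => g u.1.+1 u.2) ->
  recursive2 g.
Proof.
move=> g0 gS; have [p pP] := @recursive_in_prec nat nat id g g0 gS.
by exists p => a b; apply: (pP (a, b)).
Qed.

Lemma recursive2C g : recursive2 g -> recursive2 (fun a b => g b a).
Proof.
move=> [p pP]; exists (rComp p [:: rProj 1; rProj 0]) => a b.
apply: ev_comp (pP b a).
apply: evs_cons (ev_proj _) _ => //.
exact: evs_cons (@ev_proj 0 [:: a; b] _) (evs_nil _).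
Qed.

(** * Arithmetic, comparison and bounded choice on natural numbers *)

Lemma recursive2_add : recursive2 addn.
Proof.
apply: recursive2_prec; first exact: (@recursive_in_proj _ _ 0).
by apply: (@recursive_in_succ _ _ (fun u => u.1 + u.2)); apply: (@recursive_in_proj _ _ 1).
Qed.

Lemma recursive2_mul : recursive2 muln.
Proof.
apply: recursive2_prec; first exact: recursive_in_nat.
apply: (@recursive_in_comp2 _ _ addn (fun u => u.2) (fun u => u.1 * u.2)).
- exact: recursive2_add.
- exact: (@recursive_in_proj _ _ 2).
- exact: (@recursive_in_proj _ _ 1).
Qed.

(** The dummy argument fits the predecessor into [recursive2_prec], whose recursion carries one
    parameter. *)
Lemma recursive2_pred : recursive2 (fun a _ => a.-1).
Proof.
by apply: recursive2_prec; [exact: recursive_in_nat | exact: (@recursive_in_proj _ _ 0)].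
Qed.

Lemma recursive2_sub : recursive2 subn.
Proof.
(* Primitive recursion runs on the first argument, hence the subtrahend is put first. *)
apply: (@recursive2C (fun b a => a - b)); apply: recursive2_prec.
  apply: (@eq_recursive_in _ _ _ (fun x => x)); first by move=> x; rewrite subn0.
  exact: (@recursive_in_proj _ _ 0).
apply: (@eq_recursive_in _ _ _ (fun u => (u.2 - u.1).-1)) => [u|].
  by rewrite subnS.
apply: (@recursive_in_comp2 _ _ _ (fun u => u.2 - u.1) (fun=> 0) recursive2_pred).
- exact: (@recursive_in_proj _ _ 1).
- exact: recursive_in_nat.
Qed.

Lemma recursive2_exp : recursive2 expn.
Proof.
apply: (@recursive2C (fun b a => a ^ b)); apply: recursive2_prec.
  exact: recursive_in_nat.
apply: (@eq_recursive_in _ _ _ (fun u => u.2 * u.2 ^ u.1)) => [u|].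
  by rewrite expnS.
apply: (@recursive_in_comp2 _ _ _ (fun u => u.2) (fun u => u.2 ^ u.1) recursive2_mul).
- exact: (@recursive_in_proj _ _ 2).
- exact: (@recursive_in_proj _ _ 1).
Qed.

Section NatFunctions.
Variables (T : Type) (env : T -> seq nat).
Implicit Types (f g : T -> nat) (b c : T -> bool).

Lemma recursive_in_add f g : recursive_in env f -> recursive_in env g ->
  recursive_in env (fun x => f x + g x).
Proof. exact: recursive_in_comp2 recursive2_add. Qed.

Lemma recursive_in_mul f g : recursive_in env f -> recursive_in env g ->
  recursive_in env (fun x => f x * g x).
Proof. exact: recursive_in_comp2 recursive2_mul. Qed.

Lemma recursive_in_sub f g : recursive_in env f -> recursive_in env g ->
  recursive_in env (fun x => f x - g x).
Proof. exact: recursive_in_comp2 recursive2_sub. Qed.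

Lemma recursive_in_exp f g : recursive_in env f -> recursive_in env g ->
  recursive_in env (fun x => f x ^ g x).
Proof. exact: recursive_in_comp2 recursive2_exp. Qed.

(** Truncated subtraction [f x - g x] vanishes exactly when the comparison holds, so
    [1 - (f x - g x)] is the code of its truth value. *)
Lemma recursive_in_leq f g : recursive_in env f -> recursive_in env g ->
  recursive_in env (fun x => f x <= g x).
Proof.
move=> fR gR; apply: (@recursive_in_code _ _ _ _ (fun x => 1 - (f x - g x))).
  by apply: recursive_in_sub (recursive_in_sub fR gR); apply: recursive_in_nat.
by move=> x; rewrite /leq; case: (f x - g x) => [|[|n]].
Qed.

Lemma recursive_in_negb b : recursive_in env b -> recursive_in env (fun x => ~~ b x).
Proof.
move=> bR; apply: (@recursive_in_code _ _ _ _ (fun x => 1 - b x)).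
  by apply: recursive_in_sub bR; apply: recursive_in_nat.
by move=> x; case: (b x).
Qed.

Lemma recursive_in_andb b c : recursive_in env b -> recursive_in env c ->
  recursive_in env (fun x => b x && c x).
Proof.
move=> bR cR; apply: (@recursive_in_code _ _ _ _ (fun x => b x * c x)).
  exact: recursive_in_mul.
by move=> x; rewrite mulnb.
Qed.

Lemma recursive_in_eqn f g : recursive_in env f -> recursive_in env g ->
  recursive_in env (fun x => f x == g x).
Proof.
move=> fR gR; apply: (@eq_recursive_in _ _ _ (fun x => (f x <= g x) && (g x <= f x))).
  by move=> x; rewrite eqn_leq.
by apply: recursive_in_andb; apply: recursive_in_leq.
Qed.

Lemma recursive_in_if (B : countType) b (f1 f2 : T -> B) :
  recursive_in env b -> recursive_in env f1 -> recursive_in env f2 ->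
  recursive_in env (fun x => if b x then f1 x else f2 x).
Proof.
move=> bR f1R f2R.
apply: (@recursive_in_code _ _ _ _
    (fun x => b x * pickle (f1 x) + ~~ b x * pickle (f2 x))) => [|x].
  apply: recursive_in_add; apply: recursive_in_mul => //.
  exact: recursive_in_negb.
by case: (b x); rewrite ?mul1n ?mul0n ?addn0.
Qed.

End NatFunctions.

Lemma recursive_in_search (T : Type) (env : T -> seq nat)
    (P : nat * T -> bool) (g : T -> nat) :
  recursive_in (fun u : nat * T => u.1 :: env u.2) P ->
  (forall x, P (g x, x)) -> (forall x m, P (m, x) -> g x <= m) ->
  recursive_in env g.
Proof.
move=> /recursive_in_negb PR Pg gmin.
apply: (@recursive_in_mu _ _ (fun u => ~~ P u)) => [|x|x m].
- exact: PR.
- by rewrite Pg.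
- by rewrite ltnNge eqb0 negbK; apply: contra; apply: gmin.
Qed.

Lemma recursive2_div : recursive2 divn.
Proof.
pose env2 (u : nat * nat) := [:: u.1; u.2].
suff: recursive_in env2 (fun u => u.1 %/ u.2).
  by case=> p pP; exists p => a b; apply: (pP (a, b)).
(* The quotient is the least [q] with [a < d * q.+1]. For [d = 0] the predicate always holds and the
   search returns 0, the value of [divn]. *)
apply: (@recursive_in_search _ _
  (fun u => ~~ (0 < u.2.2) || (u.2.1 < u.2.2 * u.1.+1))) => /=.
- apply: (@eq_recursive_in _ _ _
    (fun u => ~~ ((0 < u.2.2) && (u.2.2 * u.1.+1 <= u.2.1)))) => [u|].
    by rewrite (ltnNge u.2.1) negb_and.
  apply/recursive_in_negb/recursive_in_andb; apply: recursive_in_leq.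
  + exact: recursive_in_nat.
  + exact: (@recursive_in_proj _ _ 2).
  + apply: recursive_in_mul; first exact: (@recursive_in_proj _ _ 2).
    by apply: recursive_in_succ; exact: (@recursive_in_proj _ _ 0).
  + exact: (@recursive_in_proj _ _ 1).
- by move=> [a d] /=; case: d => // d; rewrite mulnC ltn_ceil.
- move=> [a [|d]] m /=; first by rewrite divn0.
  by rewrite mulnC -ltn_divLR.
Qed.

Section Division.
Variables (T : Type) (env : T -> seq nat).
Implicit Types (f g : T -> nat).

Lemma recursive_in_div f g : recursive_in env f -> recursive_in env g ->
  recursive_in env (fun x => f x %/ g x).
Proof. exact: recursive_in_comp2 recursive2_div. Qed.

Lemma recursive_in_dvdn f g : recursive_in env f -> recursive_in env g ->
  recursive_in env (fun x => f x %| g x).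
Proof.
move=> fR gR; apply: (@eq_recursive_in _ _ _ (fun x => g x %/ f x * f x == g x)).
  by move=> x; rewrite -dvdn_eq.
apply: recursive_in_eqn => //.
by apply: recursive_in_mul => //; apply: recursive_in_div.
Qed.

End Division.

(** The 2-adic valuation of [x] is the least [k] such that [2 ^ k.+1] does not divide [x]; at
    [x = 0] the guard stops the search at 0, as [logn] requires. *)
Lemma total_recursive_logn2 : total_recursive (logn 2).
Proof.
apply: (@recursive_in_search _ (fun x => [:: x])
  (fun u => ~~ ((0 < u.2) && (2 ^ u.1.+1 %| u.2)))) => /=.
- apply/recursive_in_negb/recursive_in_andb.
    apply: recursive_in_leq; first exact: recursive_in_nat.
    exact: (@recursive_in_proj _ _ 1).
  apply: recursive_in_dvdn; last exact: (@recursive_in_proj _ _ 1).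
  apply: recursive_in_exp; first exact: recursive_in_nat.
  by apply: recursive_in_succ; exact: (@recursive_in_proj _ _ 0).
- by case=> // n; rewrite pfactor_dvdn // ltnn.
- by case=> [|n] m /=; rewrite ?logn0 // pfactor_dvdn // -leqNgt.
Qed.

(** * Codes of lists and pairs *)

Section Codes.
Variables (T : Type) (env : T -> seq nat).
Implicit Types (f g : T -> nat).

(* [logn 2] is the head of a code: [code (n :: s) = 2 ^ n * (2 * code s + 1)]. *)
Definition code_tail c := c %/ 2 ^ (logn 2 c).+1.

Lemma logn2_code n s : logn 2 (CodeSeq.code (n :: s)) = n.
Proof.
rewrite /= lognM ?expn_gt0 // pfactorK // lognE /=.
by rewrite dvdn2 /= odd_double addn0.
Qed.

(** Dividing [2 ^ n * (2 * c + 1)] by [2 ^ n.+1] leaves the integer part of [c + 1/2], which is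
    [c]. *)
Lemma code_tail_code n s : code_tail (CodeSeq.code (n :: s)) = CodeSeq.code s.
Proof.
rewrite /code_tail logn2_code /= expnSr divnMl ?expn_gt0 //.
by rewrite divn2 /= uphalf_double.
Qed.

Lemma recursive_in_code_head f :
  recursive_in env f -> recursive_in env (fun x => logn 2 (f x)).
Proof. exact: recursive_in_comp total_recursive_logn2. Qed.

Lemma recursive_in_code_tail f :
  recursive_in env f -> recursive_in env (fun x => code_tail (f x)).
Proof.
move=> fR; apply: recursive_in_div => //; apply: recursive_in_exp.
  exact: recursive_in_nat.
by apply/recursive_in_succ/recursive_in_code_head.
Qed.

Lemma recursive_in_code_cons f g :
  recursive_in env f -> recursive_in env g ->
  recursive_in env (fun x => 2 ^ f x * (g x).*2.+1).
Proof.
move=> fR gR; apply: recursive_in_mul.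
  by apply: recursive_in_exp => //; apply: recursive_in_nat.
apply: (@eq_recursive_in _ _ _ (fun x => (g x + g x).+1)).
  by move=> x; rewrite addnn.
exact/recursive_in_succ/recursive_in_add.
Qed.

Variables A B : countType.

(** A pair is coded as the list of its two component codes; the innermost [0] is the code of the
    empty list. *)
Lemma recursive_in_pair (f : T -> A) (g : T -> B) :
  recursive_in env f -> recursive_in env g -> recursive_in env (fun x => (f x, g x)).
Proof.
move=> fR gR; apply: (@recursive_in_code _ _ nat _
  (fun x => 2 ^ pickle (f x) * (2 ^ pickle (g x) * 0.*2.+1).*2.+1)) => //.
apply: recursive_in_code_cons => //; apply: recursive_in_code_cons => //.
exact: recursive_in_nat.
Qed.

Lemma recursive_in_fst (f : T -> A * B) :
  recursive_in env f -> recursive_in env (fun x => (f x).1).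
Proof.
move=> fR; apply: (@recursive_in_code _ _ nat _ (fun x => logn 2 (pickle (f x)))).
  exact: recursive_in_code_head.
by move=> x; exact: logn2_code.
Qed.

Lemma recursive_in_snd (f : T -> A * B) :
  recursive_in env f -> recursive_in env (fun x => (f x).2).
Proof.
move=> fR; apply: (@recursive_in_code _ _ nat _
  (fun x => logn 2 (code_tail (pickle (f x))))).
  exact/recursive_in_code_head/recursive_in_code_tail.
by move=> x; rewrite /= code_tail_code; exact: logn2_code.
Qed.

(** Every number codes a list, and reading past its end is harmless: the empty list has code 0,
    which [code_tail] and [logn 2] both send to 0, the default of [nth]. *)
Lemma recursive_in_nth (f : T -> nat) i :
  recursive_in env f -> recursive_in env (fun x => nth 0 (CodeSeq.decode (f x)) i).
Proof.
move=> fR.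
apply: (@eq_recursive_in _ _ _ (fun x => logn 2 (iter i code_tail (f x)))) => [x|].
  rewrite -{1}[f x]CodeSeq.decodeK; elim: i (CodeSeq.decode (f x)) => [|i IHi] s.
    by case: s => [|n s]; rewrite /= ?logn0 // logn2_code.
  case: s => [|n s]; last by rewrite iterSr code_tail_code IHi.
  by rewrite (_ : iter _ _ _ = 0) ?logn0 //; elim: (i.+1) => //= j ->.
apply: recursive_in_code_head; elim: i => //= i IHi.
exact: recursive_in_code_tail.
Qed.

End Codes.

Lemma total_recursive_pickle (A : countType) : total_recursive (@pickle A).
Proof. exact: (@recursive_in_proj _ (fun x : A => [:: pickle x]) 0). Qed.

Lemma total_recursive_id (A : countType) : total_recursive (@id A).
Proof. exact: (@recursive_in_proj _ (fun x : A => [:: pickle x]) 0). Qed.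

(** [P] is decided on all of [A], but a witness is required only on the image of [e]. In the
    application these are the triples [(n, s, approx n s)]. *)
Lemma recursive_in_search_pair (A : countType) (T : Type) (e : T -> A)
    (P : A * nat -> bool) (g : T -> nat) :
  total_recursive P -> (forall x, P (e x, g x)) ->
  (forall x m, P (e x, m) -> g x <= m) ->
  recursive_in (fun x => [:: pickle (e x)]) g.
Proof.
move=> PR Pg gmin.
apply: (@recursive_in_search _ _ (fun u : nat * T => P (e u.2, u.1))) => //.
apply: recursive_in_comp PR _; apply: recursive_in_pair.
- exact: (@recursive_in_proj _ _ 1).
- exact: (@recursive_in_proj _ _ 0).
Qed.

(** * Codes of integers *)

Section IntegerCodes.
Variables (T : Type) (env : T -> seq nat).

(** Integers are coded through the sum [nat + nat], itself a pair of options; the empty option has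
    code 0. *)
Lemma pickle_Posz n : pickle (Posz n) = CodeSeq.code [:: CodeSeq.code [:: n]; 0].
Proof. by []. Qed.

Lemma pickle_Negz n : pickle (Negz n) = CodeSeq.code [:: 0; CodeSeq.code [:: n]].
Proof. by []. Qed.

(** An integer is the difference of its two parts, at most one of which is nonzero; the successor in
    [negz_part] reflects that [Negz n] is [-(n + 1)]. *)
Definition posz_part (z : int) : nat := if z is Posz n then n else 0.
Definition negz_part (z : int) : nat := if z is Negz n then n.+1 else 0.

Lemma recursive_in_Posz (f : T -> nat) :
  recursive_in env f -> recursive_in env (fun x => Posz (f x)).
Proof.
move=> fR; apply: (@recursive_in_code _ _ nat _ (fun x =>
  2 ^ (2 ^ f x * 0.*2.+1) * (2 ^ 0 * 0.*2.+1).*2.+1)) => //.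
do !(apply: recursive_in_code_cons => //); exact: recursive_in_nat.
Qed.

Lemma recursive_in_Negz (f : T -> nat) :
  recursive_in env f -> recursive_in env (fun x => Negz (f x)).
Proof.
move=> fR; apply: (@recursive_in_code _ _ nat _ (fun x =>
  2 ^ 0 * (2 ^ (2 ^ f x * 0.*2.+1) * 0.*2.+1).*2.+1)) => //.
do !(apply: recursive_in_code_cons => //); exact: recursive_in_nat.
Qed.

Lemma recursive_in_posz_part (f : T -> int) :
  recursive_in env f -> recursive_in env (fun x => posz_part (f x)).
Proof.
move=> fR; apply: (@eq_recursive_in _ _ _
  (fun x => logn 2 (logn 2 (pickle (f x))))) => [x|]; last first.
  by do 2 apply: recursive_in_code_head.
by case: (f x) => n; rewrite ?pickle_Posz ?pickle_Negz !logn2_code // logn0.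
Qed.

Lemma recursive_in_negz_part (f : T -> int) :
  recursive_in env f -> recursive_in env (fun x => negz_part (f x)).
Proof.
(* The second slot of the code is 0 for [Posz] and [2 ^ n] for [Negz n], so testing it against 0
   decides the sign. *)
move=> fR; apply: (@eq_recursive_in _ _ _ (fun x =>
    let c := logn 2 (code_tail (pickle (f x))) in
    if c == 0 then 0 else (logn 2 c).+1)) => [x|] /=.
  case: (f x) => n; rewrite ?pickle_Posz ?pickle_Negz code_tail_code !logn2_code //.
  by rewrite /= muln1 expn_eq0.
have cR : recursive_in env (fun x => logn 2 (code_tail (pickle (f x)))).
  exact/recursive_in_code_head/recursive_in_code_tail.
apply: recursive_in_if; last exact/recursive_in_succ/recursive_in_code_head.
  by apply: recursive_in_eqn cR _; apply: recursive_in_nat.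
exact: recursive_in_nat.
Qed.

End IntegerCodes.

(* For [d > 0] this is the least [D > 0] such that [d] divides [n * D]. *)
Definition reduced_den n d := d %/ gcdn n d.

Lemma recursive2_reduced_den : recursive2 reduced_den.
Proof.
pose env2 (u : nat * nat) := [:: u.1; u.2].
suff: recursive_in env2 (fun u => reduced_den u.1 u.2).
  by case=> p pP; exists p => a b; apply: (pP (a, b)).
apply: (@recursive_in_search _ _ (fun u =>
  ~~ ((0 < u.2.2) && ~~ ((0 < u.1) && (u.2.2 %| u.2.1 * u.1))))) => /=.
- do !(apply: recursive_in_negb || apply: recursive_in_andb).
  + apply: recursive_in_leq; first exact: recursive_in_nat.
    exact: (@recursive_in_proj _ _ 2).
  + apply: recursive_in_leq; first exact: recursive_in_nat.
    exact: (@recursive_in_proj _ _ 0).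
  + apply: recursive_in_dvdn; first exact: (@recursive_in_proj _ _ 2).
    apply: recursive_in_mul; first exact: (@recursive_in_proj _ _ 1).
    exact: (@recursive_in_proj _ _ 0).
- move=> [n d] /=; rewrite negb_and negbK /reduced_den; case: posnP => //= d_gt0.
  have g_gt0 : 0 < gcdn n d by rewrite gcdn_gt0 d_gt0 orbT.
  rewrite divn_gt0 // dvdn_leq ?dvdn_gcdr //=.
  by rewrite muln_divCA_gcd dvdn_mulr.
- move=> [n d] m /=; rewrite negb_and negbK /reduced_den; case: posnP => /= [->|d_gt0].
    by rewrite div0n.
  have g_gt0 : 0 < gcdn n d by rewrite gcdn_gt0 d_gt0 orbT.
  case/andP=> m_gt0 dvd_d; apply: dvdn_leq => //.
  (* With [g = gcdn n d], the quotient [d / g] is coprime to [n / g], so it suffices that it divides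
     [(n / g) * m], which is [dvd_d] divided by [g]. *)
  rewrite -(@Gauss_dvdr _ (n %/ gcdn n d)).
    rewrite -(@dvdn_pmul2r (gcdn n d)) // divnK ?dvdn_gcdr //.
    by rewrite mulnAC divnK ?dvdn_gcdl.
  rewrite /coprime -(eqn_pmul2r g_gt0) muln_gcdl !divnK ?dvdn_gcdl ?dvdn_gcdr //.
  by rewrite gcdnC mul1n.
Qed.

(** * Rational arithmetic *)

Section Rationals.
Variables (T : Type) (env : T -> seq nat).
Local Open Scope ring_scope.
Implicit Types (f g : T -> rat).

Definition mkrat (a b d : nat) : rat := (a%:R - b%:R) / d%:R.

Lemma mkrat_parts (x : rat) :
  x = mkrat (posz_part (numq x)) (negz_part (numq x)) (posz_part (denq x)).
Proof.
rewrite /mkrat -{1}[x]divq_num_den; congr (_ / _).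
  by case: (numq x) => n; rewrite /= ?subr0 // NegzE mulrNz sub0r.
by have := denq_gt0 x; case: (denq x).
Qed.

Lemma posz_part_denq_gt0 x : (0 < posz_part (denq x))%N.
Proof. by have := denq_gt0 x; case: (denq x). Qed.

(** The code of a rational is that of its reduced fraction, so [mkrat] has to be brought to lowest
    terms by natural-number arithmetic. Here [n] is [|a - b|], since one of the truncated
    differences is 0, and [m / D] is [n / d] reduced. *)
Lemma mkrat_valq a b d (n := (a - b + (b - a))%N) (D := reduced_den n d)
    (m := (n * D %/ d)%N) : (0 < d)%N ->
  valq (mkrat a b d) = ((if (b <= a)%N then Posz m else Negz m.-1), Posz D).
Proof.
move=> d_gt0; have g_gt0 : (0 < gcdn n d)%N by rewrite gcdn_gt0 d_gt0 orbT.
have D_gt0 : (0 < D)%N by rewrite divn_gt0 // dvdn_leq ?dvdn_gcdr.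
have mE : m = (n %/ gcdn n d)%N.
  by rewrite /m /D /reduced_den muln_divCA_gcd mulKn.
have co_mD : coprime m D.
  rewrite /coprime mE -(eqn_pmul2r g_gt0) muln_gcdl !divnK ?dvdn_gcdl ?dvdn_gcdr //.
  by rewrite mul1n.
set z : int := if _ then _ else _.
have absz : `|z|%N = m.
  rewrite /z; case: leqP => //= lt_ab; rewrite prednK // mE divn_gt0 //.
  by rewrite dvdn_leq ?dvdn_gcdl // /n addn_gt0 !subn_gt0 lt_ab orbT.
have qE : mkrat a b d = z%:~R / (Posz D)%:~R.
  have eq_mD : (m * d = n * D)%N by rewrite mE /D /reduced_den muln_divCA_gcd mulnC.
  have dN0 : d%:R != 0 :> rat by rewrite pnatr_eq0 -lt0n.
  have DN0 : D%:R != 0 :> rat by rewrite pnatr_eq0 -lt0n.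
  rewrite /mkrat; apply/eqP; rewrite eqr_div // /z.
  case: leqP => le_ab.
    rewrite -natrB // -!natrM eqr_nat eq_mD.
    by move/eqP: le_ab; rewrite /n => ->; rewrite addn0.
  have m_gt0 : (0 < m)%N.
    by rewrite mE divn_gt0 // dvdn_leq ?dvdn_gcdl // /n addn_gt0 !subn_gt0 le_ab orbT.
  rewrite NegzE prednK // mulrNz mulNr -opprB mulNr -natrB 1?ltnW //.
  rewrite eqr_opp -!natrM eqr_nat eq_mD /n.
  by move/ltnW/eqP: le_ab => ->.
have valqE (x : rat) : valq x = (numq x, denq x) by case: x => -[].
rewrite valqE qE coprimeq_num ?coprimeq_den ?absz //.
by rewrite gtr0_sg ?mul1r; case: (D) D_gt0.
Qed.

Lemma recursive_in_mkrat (a b d : T -> nat) :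
  (forall x, 0 < d x)%N -> recursive_in env a -> recursive_in env b ->
  recursive_in env d -> recursive_in env (fun x => mkrat (a x) (b x) (d x)).
Proof.
move=> d_gt0 aR bR dR; pose n x := (a x - b x + (b x - a x))%N.
pose D x := reduced_den (n x) (d x); pose m x := (n x * D x %/ d x)%N.
have nR : recursive_in env n by apply: recursive_in_add; apply: recursive_in_sub.
have DR : recursive_in env D by apply: recursive_in_comp2 recursive2_reduced_den _ _.
have mR : recursive_in env m by apply: recursive_in_div => //; apply: recursive_in_mul.
apply: (@recursive_in_code _ _ (int * int)%type _ (fun x =>
  ((if (b x <= a x)%N then Posz (m x) else Negz (m x - 1)), Posz (D x)))) => [|x].
  apply: recursive_in_pair; last exact: recursive_in_Posz.
  apply: recursive_in_if; first exact: recursive_in_leq.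
    exact: recursive_in_Posz.
  by apply: recursive_in_Negz; apply: recursive_in_sub mR _; apply: recursive_in_nat.
by rewrite subn1 /m /D /n -mkrat_valq.
Qed.

Lemma recursive_in_numq f : recursive_in env f -> recursive_in env (fun x => numq (f x)).
Proof.
move=> fR; apply: (@recursive_in_fst _ _ int int (fun x => valq (f x))).
exact: recursive_in_code fR _.
Qed.

Lemma recursive_in_denq f : recursive_in env f -> recursive_in env (fun x => denq (f x)).
Proof.
move=> fR; apply: (@recursive_in_snd _ _ int int (fun x => valq (f x))).
exact: recursive_in_code fR _.
Qed.

Lemma mkratD a b d a' b' d' : (0 < d)%N -> (0 < d')%N ->
  mkrat a b d + mkrat a' b' d' =
  mkrat (a * d' + a' * d) (b * d' + b' * d) (d * d').
Proof.
move=> d_gt0 d'_gt0; rewrite /mkrat addf_div ?pnatr_eq0 -?lt0n //.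
rewrite !natrD !natrM; congr (_ / _); ring.
Qed.

Lemma mkratM a b d a' b' d' :
  mkrat a b d * mkrat a' b' d' = mkrat (a * a' + b * b') (a * b' + b * a') (d * d').
Proof.
rewrite /mkrat mulrACA -invfM !natrD !natrM; congr (_ / _); ring.
Qed.

Lemma mkratN a b d : - mkrat a b d = mkrat b a d.
Proof. by rewrite /mkrat -mulNr opprB. Qed.

Lemma mkrat_ge0 a b d : (0 < d)%N -> (0 <= mkrat a b d) = (b <= a)%N.
Proof. by move=> d_gt0; rewrite /mkrat pmulr_lge0 ?invr_gt0 ?ltr0n // subr_ge0 ler_nat. Qed.

Let parts f := recursive_in env (fun x => posz_part (numq (f x))) /\
  recursive_in env (fun x => negz_part (numq (f x))) /\
  recursive_in env (fun x => posz_part (denq (f x))).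

Let recursive_in_parts f : recursive_in env f -> parts f.
Proof.
move=> fR; split; last split.
- exact/recursive_in_posz_part/recursive_in_numq.
- exact/recursive_in_negz_part/recursive_in_numq.
- exact/recursive_in_posz_part/recursive_in_denq.
Qed.

Lemma recursive_in_addq f g : recursive_in env f -> recursive_in env g ->
  recursive_in env (fun x => f x + g x).
Proof.
move=> /recursive_in_parts[f1 [f2 f3]] /recursive_in_parts[g1 [g2 g3]].
apply: eq_recursive_in (recursive_in_mkrat _
  (recursive_in_add (recursive_in_mul f1 g3) (recursive_in_mul g1 f3))
  (recursive_in_add (recursive_in_mul f2 g3) (recursive_in_mul g2 f3))
  (recursive_in_mul f3 g3)) => x.
  by rewrite -mkratD ?posz_part_denq_gt0 // -!mkrat_parts.
by rewrite muln_gt0 !posz_part_denq_gt0.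
Qed.

Lemma recursive_in_mulq f g : recursive_in env f -> recursive_in env g ->
  recursive_in env (fun x => f x * g x).
Proof.
move=> /recursive_in_parts[f1 [f2 f3]] /recursive_in_parts[g1 [g2 g3]].
apply: eq_recursive_in (recursive_in_mkrat _
  (recursive_in_add (recursive_in_mul f1 g1) (recursive_in_mul f2 g2))
  (recursive_in_add (recursive_in_mul f1 g2) (recursive_in_mul f2 g1))
  (recursive_in_mul f3 g3)) => x.
  by rewrite -mkratM -!mkrat_parts.
by rewrite muln_gt0 !posz_part_denq_gt0.
Qed.

Lemma recursive_in_oppq f : recursive_in env f -> recursive_in env (fun x => - f x).
Proof.
move=> /recursive_in_parts[f1 [f2 f3]].
apply: eq_recursive_in (recursive_in_mkrat _ f2 f1 f3) => x.
  by rewrite -mkratN -mkrat_parts.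
exact: posz_part_denq_gt0.
Qed.

Lemma recursive_in_subq f g : recursive_in env f -> recursive_in env g ->
  recursive_in env (fun x => f x - g x).
Proof. by move=> fR gR; apply: recursive_in_addq fR (recursive_in_oppq gR). Qed.

Lemma recursive_in_leq_rat f g : recursive_in env f -> recursive_in env g ->
  recursive_in env (fun x => f x <= g x).
Proof.
move=> fR gR; have /recursive_in_parts[h1 [h2 _]] := recursive_in_subq gR fR.
apply: eq_recursive_in (recursive_in_leq h2 h1) => x.
by rewrite -subr_ge0 [in RHS](mkrat_parts (g x - f x)) mkrat_ge0 ?posz_part_denq_gt0.
Qed.

Lemma recursive_in_sum (I : Type) (r : seq I) (F : I -> T -> rat) :
  (forall i, recursive_in env (F i)) -> recursive_in env (fun x => \sum_(i <- r) F i x).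
Proof.
move=> FR; elim: r => [|i r IHr].
  by apply: eq_recursive_in (recursive_in_const _ (0 : rat)) => x; rewrite big_nil.
apply: eq_recursive_in (recursive_in_addq (FR i) IHr) => x.
by rewrite big_cons.
Qed.

Lemma recursive_in_inv2 (n : T -> nat) :
  recursive_in env n -> recursive_in env (fun x => (2^-1 ^+ n x : rat)).
Proof.
move=> nR; apply: (@eq_recursive_in _ _ _ (fun x => mkrat 1 0 (2 ^ n x))) => [x|].
  by rewrite /mkrat subr0 mul1r natrX exprVn.
apply: recursive_in_mkrat => [x|||]; rewrite ?expn_gt0 //; try exact: recursive_in_nat.
by apply: recursive_in_exp => //; apply: recursive_in_nat.
Qed.

End Rationals.

(** * Finite conjunctions and codes of matrices *)

Section FiniteFamilies.
Variables (T : Type) (env : T -> seq nat).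

Lemma recursive_in_all (I : Type) (r : seq I) (b : I -> T -> bool) :
  (forall i, recursive_in env (b i)) ->
  recursive_in env (fun x => all (b^~ x) r).
Proof.
move=> bR; elim: r => [|i r IHr] /=; first exact: recursive_in_const.
exact: recursive_in_andb.
Qed.

Lemma recursive_in_forall (I : finType) (b : I -> T -> bool) :
  (forall i, recursive_in env (b i)) ->
  recursive_in env (fun x => [forall i, b i x]).
Proof.
move=> bR; apply: eq_recursive_in (recursive_in_all (enum I) bR) => x.
by apply/allP/forallP => [H i|H i _]; apply: H; rewrite ?mem_enum.
Qed.

Variables (B : countType) (m n : nat).

(** A matrix is coded by the graph of its underlying finite function, so each entry is stored
    together with its position. *)
Lemma pickle_mx (A : 'M[B]_(m, n)) : pickle A =
  CodeSeq.code [seq CodeSeq.code [:: pickle ij; pickle (A ij.1 ij.2)]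
               | ij <- enum (('I_m * 'I_n)%type : finType)].
Proof.
transitivity (CodeSeq.code (map pickle (tval (tfgraph (mx_val A))))) => //.
congr (CodeSeq.code _); rewrite -codom_tffun /codom /image_mem -map_comp.
by apply: eq_map => -[i j] /=; case: A.
Qed.

Lemma recursive_in_mx (A : T -> 'M[B]_(m, n)) :
  (forall i j, recursive_in env (fun x => A x i j)) -> recursive_in env A.
Proof.
move=> AR; apply: (@recursive_in_code _ _ nat _ (fun x => CodeSeq.code
  [seq CodeSeq.code [:: pickle ij; pickle (A x ij.1 ij.2)]
  | ij <- enum (('I_m * 'I_n)%type : finType)])) => [|x]; last by rewrite pickle_mx.
(* The list of positions is fixed, so the program is assembled by induction along it. *)
elim: (enum _) => [|[i j] r IHr] /=; first exact: recursive_in_nat.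
apply: recursive_in_code_cons IHr; apply: recursive_in_code_cons.
  exact: recursive_in_nat.
by apply: recursive_in_code_cons (AR i j) _; apply: recursive_in_nat.
Qed.

Lemma recursive_in_entry (A : T -> 'M[B]_(m, n)) i j :
  recursive_in env A -> recursive_in env (fun x => A x i j).
Proof.
move=> AR; pose k := index (i, j) (enum (('I_m * 'I_n)%type : finType)).
apply: (@recursive_in_code _ _ nat _ (fun x =>
  nth 0 (CodeSeq.decode (nth 0 (CodeSeq.decode (pickle (A x))) k)) 1)) => [|x].
  exact/recursive_in_nth/recursive_in_nth.
have ij_in : (i, j) \in enum (('I_m * 'I_n)%type : finType) by rewrite mem_enum.
rewrite pickle_mx CodeSeq.codeK (nth_map (i, j)) ?index_mem //.
by rewrite /k nth_index // CodeSeq.codeK.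
Qed.

End FiniteFamilies.

(** * Positive semi-definite matrices *)

Section PositiveMatrices.
Variable R : realType.
Local Notation C := (R[i]).
Local Open Scope sesquilinear_scope.
Local Open Scope ring_scope.

Lemma adjE m n (A : 'M[C]_(m, n)) i j : adj A i j = (A j i)^*.
Proof. by rewrite !mxE. Qed.

Lemma adjM m n p (A : 'M[C]_(m, n)) (B : 'M[C]_(n, p)) :
  adj (A *m B) = adj B *m adj A.
Proof. by rewrite /adj map_mxM trmx_mul. Qed.

Lemma adjD m n (A B : 'M[C]_(m, n)) : adj (A + B) = adj A + adj B.
Proof. by rewrite /adj map_mxD linearD. Qed.

Lemma adjN m n (A : 'M[C]_(m, n)) : adj (- A) = - adj A.
Proof. by rewrite /adj map_mxN linearN. Qed.

Lemma adjK m n (A : 'M[C]_(m, n)) : adj (adj A) = A.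
Proof. by apply/matrixP=> i j; rewrite !adjE conjCK. Qed.

Variable N : nat.
Implicit Types (A B D : 'M[C]_N) (v : 'cV[C]_N).

Definition qform A v : C := (adj v *m A *m v) 0 0.

Lemma qformD A B v : qform (A + B) v = qform A v + qform B v.
Proof. by rewrite /qform mulmxDr mulmxDl mxE. Qed.

Lemma qformE A v : qform A v = \sum_i \sum_j (v i 0)^* * A i j * v j 0.
Proof.
rewrite /qform mxE exchange_big /=; apply: eq_bigr => j _.
by rewrite mxE mulr_suml; apply: eq_bigr => i _; rewrite adjE.
Qed.

Lemma qform_scalar (a : C) v : qform a%:M v = a * \sum_i `|v i 0| ^+ 2.
Proof.
rewrite /qform mul_mx_scalar -scalemxAl mxE; congr (_ * _).
by rewrite mxE; apply: eq_bigr => i _; rewrite adjE mulrC normCK.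
Qed.

Lemma qform_adj A v : (qform A v)^* = qform (adj A) v.
Proof.
rewrite /qform -[LHS](adjE (adj v *m A *m v)).
by rewrite !adjM adjK mulmxA.
Qed.

Lemma qform_real A v : hermitian A -> qform A v \is Num.real.
Proof. by move=> hA; apply/CrealP; rewrite qform_adj hA. Qed.

Lemma hermitianD A B : hermitian A -> hermitian B -> hermitian (A + B).
Proof. by rewrite /hermitian adjD => -> ->. Qed.

Lemma hermitianN A : hermitian A -> hermitian (- A).
Proof. by rewrite /hermitian adjN => ->. Qed.

Lemma hermitianB A B : hermitian A -> hermitian B -> hermitian (A - B).
Proof. by move=> hA /hermitianN; apply: hermitianD. Qed.

Lemma hermitian_scalar (a : C) : a \is Num.real -> hermitian (a%:M : 'M[C]_N).
Proof.
move=> /CrealP a_real; apply/matrixP => i j; rewrite adjE !mxE eq_sym.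
case: eqP => _; rewrite ?mulr1n ?mulr0n ?conjC0 //.
Qed.

Lemma psd_scalar (a : C) : 0 <= a -> psd (a%:M : 'M[C]_N).
Proof.
move=> a_ge0; split=> [|v]; first exact/hermitian_scalar/ger0_real.
by rewrite -/(qform _ _) qform_scalar mulr_ge0 // sumr_ge0 // => i _; rewrite exprn_ge0.
Qed.

Lemma psdD A B : psd A -> psd B -> psd (A + B).
Proof.
move=> [hA pA] [hB pB]; split=> [|v]; first exact: hermitianD.
by rewrite -/(qform _ _) qformD; apply: addr_ge0; [exact: pA | exact: pB].
Qed.

Lemma psd0 : psd (0 : 'M[C]_N).
Proof. by have := @psd_scalar 0 (lexx _); rewrite raddf0. Qed.

Lemma psd_sum (I : Type) (r : seq I) (F : I -> 'M[C]_N) :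
  (forall i, psd (F i)) -> psd (\sum_(i <- r) F i).
Proof. by move=> Fp; elim/big_ind: _ => //; [exact: psd0 | exact: psdD]. Qed.

Lemma loewner_trans B A D : loewner A B -> loewner B D -> loewner A D.
Proof. by move=> AB /psdD/(_ AB); rewrite /loewner subrKA. Qed.

Lemma loewner_sum (I : Type) (r : seq I) (F G : I -> 'M[C]_N) :
  (forall i, loewner (F i) (G i)) ->
  loewner (\sum_(i <- r) F i) (\sum_(i <- r) G i).
Proof. by move=> FG; rewrite /loewner -sumrB; apply: psd_sum. Qed.

Lemma posdef_psd A : posdef A -> psd A.
Proof.
case=> hA pA; split=> // v; have [->|/pA/ltW//] := eqVneq v 0.
by rewrite mulmx0 mxE.
Qed.

Lemma posdef_add_psd A B : posdef A -> psd B -> posdef (A + B).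
Proof.
move=> [hA pA] [hB pB]; split=> [|v /pA]; first exact: hermitianD.
rewrite -!/(qform _ _) qformD => A_gt0; exact: ltr_wpDr (pB v) A_gt0.
Qed.

Lemma posdef_scalar (a : C) : 0 < a -> posdef (a%:M : 'M[C]_N).
Proof.
move=> a_gt0; split=> [|v v_neq0]; first exact/hermitian_scalar/gtr0_real.
rewrite -/(qform _ _) qform_scalar mulr_gt0 // lt0r sumr_ge0 ?andbT; last first.
  by move=> i _; rewrite exprn_ge0.
apply: contra v_neq0 => /eqP sum0; apply/eqP/matrixP => i j; rewrite ord1 mxE.
have ge0 k : true -> 0 <= `|v k 0| ^+ 2 by rewrite exprn_ge0.
by have /(_ i isT)/eqP := psumr_eq0P ge0 sum0; rewrite sqrf_eq0 normr_eq0 => /eqP.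
Qed.

Lemma psd_gram B : psd (adj B *m B).
Proof.
split=> [|v]; first by rewrite /hermitian adjM adjK.
rewrite mulmxA -adjM -mulmxA mxE sumr_ge0 // => i _.
by rewrite adjE mulrC -normCK exprn_ge0.
Qed.

(** The form of [E] at [v] is at most the sum of [eta |v_i| |v_j|], and
    [|v_i| |v_j| <= (|v_i|^2 + |v_j|^2) / 2] bounds this by [N eta] times the squared norm of
    [v]. *)
Lemma psd_entrywise (E : 'M[C]_N) (eta : C) : 0 <= eta -> hermitian E ->
  (forall i j, `|E i j| <= eta) -> psd (E + (N%:R * eta)%:M).
Proof.
move=> eta_ge0 hE E_le.
have eta_real := ger0_real eta_ge0.
split=> [|v].
  apply: hermitianD => //; apply: hermitian_scalar.
  by rewrite realM ?realn.
rewrite -/(qform _ _) qformD qform_scalar.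
set S := \sum_i _.
suff : `|qform E v| <= N%:R * eta * S.
  by rewrite real_ler_norml ?qform_real // => /andP[+ _]; rewrite -subr_ge0 opprK addrC.
rewrite qformE; apply: le_trans (ler_norm_sum _ _ _) _.
pose w i := `|v i 0| : C.
apply: (@le_trans _ _ (\sum_i \sum_j (eta * ((w i ^+ 2 + w j ^+ 2) / 2)))).
  apply: ler_sum => i _; apply: le_trans (ler_norm_sum _ _ _) _.
  apply: ler_sum => j _; rewrite !normrM norm_conjC -/(w i) -/(w j).
  rewrite mulrAC mulrC; apply: ler_pM => //; first by rewrite mulr_ge0 ?normr_ge0.
  rewrite ler_pdivlMr // -subr_ge0.
  have -> : w i ^+ 2 + w j ^+ 2 - w i * w j * 2 = (w i - w j) ^+ 2 by ring.
  by apply: real_exprn_even_ge0 => //; rewrite realB ?normr_real.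
have sumw : \sum_i w i ^+ 2 = S by [].
under eq_bigr => i _ do rewrite -mulr_sumr -mulr_suml big_split /= sumr_const card_ord sumw.
rewrite -mulr_sumr -mulr_suml big_split /= sumr_const card_ord.
rewrite sumrMnl sumw -[S *+ N]mulr_natl.
rewrite le_eqVlt; apply/orP; left; apply/eqP.
by field.
Qed.

(** The spectral theorem gives [A = P^* D P] with [P] unitary and [D] diagonal; [S] is the square
    root of [D] times [P]. *)
Lemma psd_factor A : psd A -> exists S : 'M[C]_N, A = adj S *m S.
Proof.
move=> [hA pA].
have hermA : A \is hermsymmx.
  by apply/is_hermitianmxP; rewrite expr0 scale1r -{1}hA /adj map_trmx.
have /hermitian_normalmx /orthomx_spectralP := hermA.
set P := spectralmx A; set d := spectral_diag A.
have Pu : P \is unitarymx := spectral_unitarymx A.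
rewrite invmx_unitary // => AE.
have adjP : P ^t* = adj P by rewrite /adj map_trmx.
have PP : P *m adj P = 1%:M by rewrite -adjP; apply/unitarymxP.
have d_ge0 i : 0 <= d 0 i.
  (* Column [i] of [P^*] is an eigenvector, and the form takes the eigenvalue [d 0 i] on it. *)
  have := pA (adj P *m delta_mx i 0).
  rewrite adjM adjK AE adjP.
  rewrite -!mulmxA (mulmxA P) PP mul1mx (mulmxA P) PP mul1mx.
  have -> : adj (delta_mx i 0 : 'cV[C]_N) = delta_mx 0 i.
    apply/matrixP => a b; rewrite adjE !mxE ord1 eqxx andbT /=.
    by case: (b == i); rewrite ?conjC0 ?conjC1.
  by rewrite -rowE -colE !mxE eqxx mulr1n.
exists (diag_mx (map_mx sqrtC d) *m P).
rewrite adjM AE adjP !mulmxA; congr (_ *m P); rewrite -mulmxA; congr (adj P *m _).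
have -> : adj (diag_mx (map_mx sqrtC d)) = diag_mx (map_mx sqrtC d).
  apply/matrixP => i j; rewrite adjE !mxE eq_sym.
  case: eqP => [->|_]; rewrite ?mulr0n ?conjC0 // !mulr1n.
  by rewrite geC0_conj // sqrtC_ge0.
rewrite mulmx_diag; congr diag_mx; apply/matrixP => i j; rewrite !mxE ord1.
by rewrite -expr2 sqrtCK.
Qed.

Lemma psd_diag_ge0 A i : psd A -> 0 <= A i i.
Proof.
case/psd_factor => S ->; rewrite mxE sumr_ge0 // => k _.
by rewrite adjE mulrC -normCK exprn_ge0.
Qed.

(** Writing [A = S^* S], the inequality [|x| |y| <= (|x|^2 + |y|^2) / 2] gives
    [|A_ij| <= (A_ii + A_jj) / 2], and no diagonal entry exceeds the trace. *)
Lemma psd_entry_le_trace A i j : psd A -> `|A i j| <= \tr A.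
Proof.
move=> pA; have diag k := psd_diag_ge0 k pA.
have [S AE] := psd_factor pA.
have AkE k : A k k = \sum_l `|S l k| ^+ 2.
  by rewrite AE mxE; apply: eq_bigr => l _; rewrite adjE mulrC normCK.
have le_tr k : A k k <= \tr A.
  by rewrite /mxtrace (bigD1 k) //= ler_wpDr // sumr_ge0.
apply: (@le_trans _ _ ((A i i + A j j) / 2)); last first.
  rewrite ler_pdivrMr // mulr_natr mulr2n; exact: lerD.
rewrite !AkE -big_split /= mulr_suml [in `|A i j|]AE mxE.
apply: le_trans (ler_norm_sum _ _ _) _; apply: ler_sum => l _.
rewrite adjE normrM norm_conjC ler_pdivlMr // -subr_ge0.
set x := `|S l i|; set y := `|S l j|.
have -> : x ^+ 2 + y ^+ 2 - x * y * 2 = (x - y) ^+ 2 by ring.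
by apply: real_exprn_even_ge0 => //; rewrite realB ?normr_real.
Qed.

End PositiveMatrices.

(** * The operator norm compared with the largest entry *)

Section OperatorNorm.
Variable R : realType.
Local Notation C := (R[i]).
Local Notation toC := (real_complex R).
Local Open Scope ring_scope.
Variable N : nat.
Implicit Types (A : 'M[C]_N) (v : 'cV[C]_N).

Lemma vnorm_ge0 v : 0 <= vnorm v.
Proof. exact: sqrtr_ge0. Qed.

Lemma sqr_vnorm v : toC (vnorm v) ^+ 2 = \sum_i `|v i 0| ^+ 2.
Proof.
rewrite -rmorphXn sqr_sqrtr; last first.
  by apply: sumr_ge0 => i _; rewrite addr_ge0 ?sqr_ge0.
by rewrite rmorph_sum; apply: eq_bigr => i _; apply: add_Re2_Im2.
Qed.

Lemma coord_le_vnorm v i : `|v i 0| <= toC (vnorm v).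
Proof.
rewrite -(@ler_pXn2r _ 2) ?nnegrE ?normr_ge0 ?ler0c ?vnorm_ge0 // sqr_vnorm.
by rewrite (bigD1 i) //= ler_wpDr // sumr_ge0 // => j _; rewrite exprn_ge0.
Qed.

(** The Euclidean bound would have factor [sqrt N]; the cruder [N] follows from [N <= N^2] and
    avoids the root. *)
Lemma vnorm_le v (b : R) : 0 <= b ->
  (forall i, `|v i 0| <= toC b) -> vnorm v <= N%:R * b.
Proof.
move=> b_ge0 v_le; have Nb_ge0 : 0 <= N%:R * b by rewrite mulr_ge0.
rewrite -(@ler_pXn2r _ 2) ?nnegrE ?vnorm_ge0 // -lecR.
rewrite [toC (vnorm v ^+ 2)]rmorphXn sqr_vnorm.
apply: (@le_trans _ _ (\sum_(i < N) toC (b ^+ 2))).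
  apply: ler_sum => i _; rewrite rmorphXn ler_pXn2r ?nnegrE ?normr_ge0 ?ler0c //.
rewrite sumr_const card_ord -rmorphMn lecR -mulr_natl exprMn ler_wpM2r ?sqr_ge0 //.
by rewrite -natrX ler_nat; case: (N) => // n; rewrite -{1}[n.+1]expn1 leq_pexp2l.
Qed.

Lemma vnorm_mulmx_le A v (b : R) : 0 <= b -> (forall i j, `|A i j| <= toC b) ->
  vnorm v <= 1 -> vnorm (A *m v) <= N%:R * (N%:R * b).
Proof.
move=> b_ge0 A_le v_le1; apply: vnorm_le => [|i]; first by rewrite mulr_ge0.
rewrite mxE; apply: le_trans (ler_norm_sum _ _ _) _.
apply: (@le_trans _ _ (\sum_(j < N) toC b)).
  apply: ler_sum => j _; rewrite normrM -[toC b]mulr1; apply: ler_pM => //.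
  by apply: le_trans (coord_le_vnorm v j) _; rewrite (lecR _ 1).
by rewrite sumr_const card_ord -rmorphMn mulr_natl.
Qed.

Lemma vnorm0 : vnorm (0 : 'cV[C]_N) = 0.
Proof. by rewrite /vnorm big1 ?sqrtr0 // => i _; rewrite mxE /= expr0n /= addr0. Qed.

Lemma opnorm_le A (b : R) : 0 <= b -> (forall i j, `|A i j| <= toC b) ->
  opnorm A <= N%:R * (N%:R * b).
Proof.
move=> b_ge0 A_le; apply: ge_sup.
  by exists (vnorm (A *m 0)), 0 => //=; rewrite vnorm0.
by move=> _ [v /= v_le1 <-]; apply: vnorm_mulmx_le.
Qed.

(** Supplies the finite bound under which the supremum defining [opnorm] is a genuine upper
    bound. *)
Lemma entries_bounded m n (A : 'M[C]_(m, n)) :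
  exists2 b : R, 0 <= b & forall i j, `|A i j| <= toC b.
Proof.
have S_ge0 : 0 <= \sum_i \sum_j `|A i j| :> C.
  by apply: sumr_ge0 => i _; apply: sumr_ge0.
exists (complex.Re (\sum_i \sum_j `|A i j|)) => [|i j].
  by rewrite -ler0c RRe_real ?ger0_real.
rewrite RRe_real ?ger0_real // (bigD1 i) //= (bigD1 j) //= -addrA ler_wpDr //.
by apply: addr_ge0; apply: sumr_ge0 => // k _; apply: sumr_ge0.
Qed.

(** The entry is a coordinate of the image of the unit vector [e] along axis [j]. *)
Lemma entry_le_opnorm A i j : `|A i j| <= toC (opnorm A).
Proof.
have [b b_ge0 A_le] := entries_bounded A.
pose e := delta_mx j 0 : 'cV[C]_N.
have eE : vnorm e = 1.
  have /eqP := sqr_vnorm e; rewrite (bigD1 j) //= big1 => [|k kj]; last first.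
    by rewrite mxE (negPf kj) normr0 expr0n.
  rewrite mxE !eqxx normr1 expr1n addr0 -rmorphXn (inj_eq (@complexI R) _ 1).
  by rewrite sqrp_eq1 ?vnorm_ge0 // => /eqP.
have -> : A i j = (A *m e) i 0 by rewrite -colE mxE.
apply: le_trans (coord_le_vnorm _ _) _; rewrite lecR; apply: ub_le_sup.
  exists (N%:R * (N%:R * b)) => _ [v /= v_le1 <-]; exact: vnorm_mulmx_le.
by exists e => //=; rewrite eE.
Qed.

Lemma norm_Complex_le (a b : R) : `|Complex a b| <= toC (`|a| + `|b|).
Proof.
rewrite normc_def lecR /= -[leRHS]ger0_norm ?addr_ge0 // -sqrtr_sqr.
rewrite ler_sqrt ?sqr_ge0 // sqrrD.
by rewrite !real_normK ?num_real // lerD2r lerDl mulrn_wge0 // mulr_ge0.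
Qed.

Lemma norm_Re_le (z : C) (b : R) : `|z| <= toC b -> `|complex.Re z| <= b.
Proof. by move=> /(le_trans (normc_ge_Re z)); rewrite lecR. Qed.

Lemma norm_Im_le (z : C) (b : R) : `|z| <= toC b -> `|complex.Im z| <= b.
Proof.
move=> zb; rewrite -lecR; apply: le_trans zb; rewrite normc_def lecR.
by rewrite -sqrtr_sqr ler_sqrt ?lerDr ?addr_ge0 ?sqr_ge0.
Qed.

End OperatorNorm.

(** * Rational certificates of positivity *)

Section RationalMatrices.
Variable R : realType.
Local Notation C := (R[i]).
Local Notation toC := (real_complex R).
Local Open Scope ring_scope.
Variable N : nat.
Implicit Types (X Y A B H : QCmat N).

Definition complexQ (a b : rat) : C := Complex (ratr a) (ratr b).

Lemma complexQD a b a' b' :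
  complexQ (a + a') (b + b') = complexQ a b + complexQ a' b'.
Proof. by rewrite /complexQ !rmorphD. Qed.

Lemma complexQ_sum (I : Type) (r : seq I) (F G : I -> rat) :
  complexQ (\sum_(i <- r) F i) (\sum_(i <- r) G i) =
  \sum_(i <- r) complexQ (F i) (G i).
Proof.
elim: r => [|i r IHr]; first by rewrite !big_nil /complexQ rmorph0.
by rewrite !big_cons complexQD IHr.
Qed.

Lemma complexQ_conjM a b a' b' :
  complexQ (a * a' + b * b') (a * b' - b * a') = (complexQ a b)^* * complexQ a' b'.
Proof.
rewrite /complexQ !rmorphD !rmorphN !rmorphM /=.
apply/eqP; rewrite eq_complex /=; apply/andP; split; apply/eqP; ring.
Qed.

Lemma embQE X i j : embQ R X i j = complexQ (X.1 i j) (X.2 i j).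
Proof. by rewrite mxE. Qed.

Lemma embQB X Y : embQ R (X - Y) = embQ R X - embQ R Y.
Proof.
by apply/matrixP => i j; rewrite !mxE /= !rmorphB.
Qed.

Definition scalarQ (a : rat) : QCmat N := (a%:M, 0).

Lemma embQ_scalar a : embQ R (scalarQ a) = (toC (ratr a))%:M.
Proof.
apply/matrixP => i j; rewrite embQE !mxE /complexQ rmorph0.
by case: eqP => _; rewrite ?mulr1n // mulr0n rmorph0.
Qed.

(** Real and imaginary parts of [B^* B], computed over the rationals. *)
Definition gramQ B : QCmat N :=
  (\matrix_(i, j) \sum_k (B.1 k i * B.1 k j + B.2 k i * B.2 k j),
   \matrix_(i, j) \sum_k (B.1 k i * B.2 k j - B.2 k i * B.1 k j)).

Lemma embQ_gram B : embQ R (gramQ B) = adj (embQ R B) *m embQ R B.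
Proof.
apply/matrixP => i j; rewrite embQE /= !mxE complexQ_sum.
by apply: eq_bigr => k _; rewrite complexQ_conjM adjE !embQE.
Qed.

Definition smallQ (eta : rat) (x : rat) := (- eta <= x) && (x <= eta).

(** A decidable test. The tolerance leaves room for a rational [B] and lets a single [B] serve all
    [A] close enough to the limit. *)
Definition psd_certificate (eta : rat) A H B : bool :=
  [forall i, [forall j, smallQ eta (A.1 i j - H.1 i j - (gramQ B).1 i j) &&
                        smallQ eta (A.2 i j - H.2 i j - (gramQ B).2 i j)]].

Lemma smallQE eta x : smallQ eta x = (`|x| <= eta).
Proof. by rewrite ler_norml. Qed.

Lemma psd_certificateP eta A H B : reflect
  (forall i j, `|(A - H - gramQ B).1 i j| <= eta /\ `|(A - H - gramQ B).2 i j| <= eta)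
  (psd_certificate eta A H B).
Proof.
have E1 i j : (A - H - gramQ B).1 i j = A.1 i j - H.1 i j - (gramQ B).1 i j.
  by rewrite !mxE.
have E2 i j : (A - H - gramQ B).2 i j = A.2 i j - H.2 i j - (gramQ B).2 i j.
  by rewrite !mxE.
apply: (iffP forallP) => [h i j|h i].
  by have /forallP/(_ j)/andP[] := h i; rewrite !smallQE E1 E2.
by apply/forallP => j; have [] := h i j; rewrite !smallQE E1 E2 => -> ->.
Qed.

(** Errors of at most [eta] in real and imaginary part give modulus at most [2 * eta], which
    [psd_entrywise] absorbs at the cost of a factor [N]. *)
Lemma psd_certificate_sound eta A H B : 0 <= eta ->
  in_HerQ R A -> in_HerQ R H -> psd_certificate eta A H B ->
  psd (embQ R A - embQ R H + (toC (ratr (N%:R * (2 * eta))))%:M).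
Proof.
move=> eta_ge0 hA hH /psd_certificateP cert.
have -> : embQ R A - embQ R H =
    embQ R (A - H - gramQ B) + adj (embQ R B) *m embQ R B.
  by rewrite !embQB embQ_gram subrK.
rewrite addrAC; apply: psdD (psd_gram _).
have -> : toC (ratr (N%:R * (2 * eta))) = N%:R * toC (ratr (2 * eta)).
  have -> : ratr (N%:R * (2 * eta)) = N%:R * ratr (2 * eta) :> R.
    by rewrite [LHS]rmorphM /= ratr_nat.
  by rewrite [LHS]rmorphM /= rmorph_nat.
apply: psd_entrywise => [||i j].
- by rewrite ler0c ler0q mulr_ge0.
- rewrite !embQB embQ_gram; apply: hermitianB; first exact: hermitianB.
  by have [] := psd_gram (embQ R B).
- rewrite embQE; have [le1 le2] := cert i j.
  apply: le_trans (norm_Complex_le _ _) _; rewrite lecR -!ratr_norm -rmorphD.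
  by rewrite ler_rat /= mulr2n mulrDl !mul1r lerD.
Qed.

Lemma rat_approx (x d : R) : 0 < d -> exists q : rat, `|x - ratr q| <= d.
Proof.
move=> d_gt0; have [|q] := @rat_in_itvoo _ (x - d) (x + d).
  by rewrite ltrD2l gtrN.
rewrite in_itv /= => /andP[lt1 lt2]; exists q; rewrite ler_norml; apply/andP; split; lra.
Qed.

Lemma embQ_approx (S : 'M[C]_N) (d : R) : 0 < d ->
  exists B, forall i j, `|S i j - embQ R B i j| <= toC d.
Proof.
move=> d_gt0; have d2_gt0 : 0 < d / 2 by rewrite divr_gt0.
have app x := rat_approx x d2_gt0; pose q x := projT1 (cid (app x)).
have qP x : `|x - ratr (q x)| <= d / 2 := projT2 (cid (app x)).
exists (\matrix_(i, j) q (complex.Re (S i j)), \matrix_(i, j) q (complex.Im (S i j))) => i j.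
rewrite !mxE /=; case: (S i j) => a b /=.
apply: le_trans (norm_Complex_le (a - ratr (q a)) (b - ratr (q b))) _.
by rewrite lecR [d]splitr lerD.
Qed.

(** Factor the gap as [S^* S] and round [S] to a rational [B]: half of the tolerance pays for the
    rounding, half for replacing [M] by [A]. Thus [B] is chosen before [A]. *)
Lemma psd_certificate_complete (M : 'M[C]_N) H (eta : rat) : 0 < eta ->
  psd (M - embQ R H) ->
  exists B, exists2 eps : R, 0 < eps &
    forall A, opnorm (embQ R A - M) <= eps -> psd_certificate eta A H B.
Proof.
move=> eta_gt0 /psd_factor[S MHE].
have [K K_ge0 S_le] := entries_bounded S.
pose e : R := ratr eta; have e_gt0 : 0 < e by rewrite ltr0q.
pose L : R := N%:R * (K + (K + 1)).
have L_ge0 : 0 <= L by rewrite mulr_ge0 // addr_ge0 // addr_ge0.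
(* The bound 1 keeps the entries of the rounded matrix below [K + 1]; the other bound gives
   [d * L <= e / 2], where [d * L] bounds the change in each Gram entry. Using [L + 1] avoids
   division by 0. *)
pose d : R := Num.min 1 (e / 2 / (L + 1)).
have L1_gt0 : 0 < L + 1 by rewrite ltr_wpDl.
have d_gt0 : 0 < d.
  by rewrite /d lt_min ltr01 /=; do !apply: divr_gt0 => //.
have d_le1 : d <= 1 by rewrite ge_min lexx.
have dL_le : d * L <= e / 2.
  apply: (@le_trans _ _ (d * (L + 1))); first by rewrite ler_pM2l // lerDl.
  by rewrite -ler_pdivlMr // ge_min lexx orbT.
have [B B_le] := embQ_approx S d_gt0; exists B, (e / 2); first by rewrite divr_gt0.
move=> A A_le; set T := embQ R B.
have T_le i j : `|T i j| <= toC (K + 1).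
  rewrite -[T i j](subKr (S i j)); apply: le_trans (ler_normB _ _) _.
  rewrite rmorphD; apply: lerD => //; apply: le_trans (B_le i j) _.
  by rewrite lecR.
have gram_le i j : `|(adj S *m S - adj T *m T) i j| <= toC (e / 2).
  apply: (@le_trans _ _ (toC (d * L))); last by rewrite lecR.
  rewrite !mxE -sumrB; apply: le_trans (ler_norm_sum _ _ _) _.
  have -> : toC (d * L) = \sum_(k < N) (toC d * toC K + toC (K + 1) * toC d).
    rewrite sumr_const card_ord -!rmorphM -rmorphD -rmorphMn /L.
    by congr toC; rewrite -mulr_natl; ring.
  apply: ler_sum => k _; rewrite !adjE.
  have -> : (S k i)^* * S k j - (T k i)^* * T k j =
      (S k i - T k i)^* * S k j + (T k i)^* * (S k j - T k j).
    by rewrite rmorphB; ring.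
  apply: le_trans (ler_normD _ _) _; rewrite !normrM !norm_conjC; apply: lerD.
    exact: ler_pM (B_le _ _) (S_le _ _).
  exact: ler_pM (T_le _ _) (B_le _ _).
have main i j : `|embQ R (A - H - gramQ B) i j| <= toC e.
  have -> : embQ R (A - H - gramQ B) =
      (embQ R A - M) + (adj S *m S - adj T *m T).
    by rewrite !embQB embQ_gram -MHE; rewrite addrA subrKA.
  rewrite mxE; apply: le_trans (ler_normD _ _) _; rewrite [e]splitr rmorphD.
  apply: lerD (gram_le i j); apply: le_trans (entry_le_opnorm _ _ _) _.
  by rewrite lecR.
apply/psd_certificateP => i j; have := main i j; rewrite embQE.
by split; [have := norm_Re_le (main i j) | have := norm_Im_le (main i j)];
  rewrite embQE /= -ratr_norm ler_rat.
Qed.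

End RationalMatrices.

(** * Traces of semi-POVMs and a summable scalar family *)

Section SemiPOVM.
Variable R : realType.
Local Notation C := (R[i]).
Local Notation toC := (real_complex R).
Local Open Scope ring_scope.
Variable N : nat.

Lemma psd_trace_ge0 (A : 'M[C]_N) : psd A -> 0 <= \tr A.
Proof. by move=> pA; apply: sumr_ge0 => i _; apply: psd_diag_ge0. Qed.

Lemma loewner_trace (A B : 'M[C]_N) : loewner A B -> \tr A <= \tr B.
Proof. by move=> /psd_trace_ge0; rewrite linearB /= subr_ge0. Qed.

(** Without such a list, strings of trace at least [eps] could be collected without end, and enough
    of them would exceed the trace [N] of the identity. *)
Lemma semiPOVM_trace_small (M : bstring -> 'M[C]_N) (eps : R) :
  semiPOVM M -> 0 < eps ->
  exists l : seq bstring, forall s, s \notin l -> \tr (M s) <= toC eps.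
Proof.
move=> [M_psd M_sum] eps_gt0; apply: contrapT => no_list.
have many n : exists l : seq bstring,
    [/\ uniq l, size l = n & forall s, s \in l -> toC eps <= \tr (M s)].
  elim: n => [|n [l [l_uniq l_size l_big]]]; first by exists [::].
  have : ~ (forall s, s \notin l -> \tr (M s) <= toC eps).
    by move=> hl; apply: no_list; exists l.
  move=> /existsNP[s /not_implyP[s_notin big]]; exists (s :: l).
  split; rewrite /= ?s_notin ?l_size // => t; rewrite inE => /predU1P[->|/l_big//].
  have real_tr : \tr (M s) \is Num.real by apply/ger0_real/psd_trace_ge0.
  have real_eps : toC eps \is Num.real by apply/ger0_real; rewrite ler0c ltW.
  by have [/big|/ltW] := real_leP real_tr real_eps.
(* More than [N / eps] strings, so that their total trace exceeds [N]. *)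
have [l [l_uniq l_size l_big]] := many (Num.bound (N%:R / eps)).
have := loewner_trace (M_sum l l_uniq); rewrite linear_sum mxtrace1 /=.
apply/negP; rewrite -real_ltNge ?realn //; last first.
  by apply: rpred_sum => s _; apply/ger0_real/psd_trace_ge0.
apply: (@lt_le_trans _ _ (toC (eps *+ size l))).
  rewrite -(rmorph_nat toC) ltcR l_size -[eps *+ _]mulr_natr -ltr_pdivrMl // mulrC.
  by apply: archi_boundP; rewrite divr_ge0 // ltW.
have <- : \sum_(s <- l) toC eps = toC (eps *+ size l).
  by rewrite big_const_seq count_predT iter_addr_0 rmorphMn.
by rewrite big_seq [leRHS]big_seq; apply: ler_sum => s /l_big.
Qed.

(** Distinct strings have distinct codes, so the sum is part of a finite geometric sum
    [1 - 2^-K]. *)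
Lemma sum_inv2_le1 (l : seq bstring) : uniq l ->
  \sum_(s <- l) (2^-1 ^+ (pickle s).+1 : rat) <= 1.
Proof.
move=> l_uniq; rewrite -(big_map pickle xpredT (fun n => 2^-1 ^+ n.+1 : rat)).
have {l_uniq} : uniq (map pickle l) by rewrite map_inj_uniq //; apply: pcan_inj pickleK.
move: (map _ l) => r r_uniq; pose K := (\max_(n <- r) n).+1.
have ltK n : n \in r -> (n < K)%N by move=> n_in; rewrite ltnS (@leq_bigmax_seq _ _ xpredT id).
have /(perm_big _)-> : perm_eq r [seq n <- iota 0 K | n \in r].
  apply: uniq_perm; rewrite ?filter_uniq ?iota_uniq // => n.
  by rewrite mem_filter mem_iota /= add0n andb_idr // => /ltK.
rewrite big_filter big_mkcond.
apply: (@le_trans _ _ (\sum_(n <- iota 0 K) 2^-1 ^+ n.+1)).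
  by apply: ler_sum => n _; case: ifP => // _; rewrite exprn_ge0.
suff -> : \sum_(n <- iota 0 K) 2^-1 ^+ n.+1 = 1 - 2^-1 ^+ K :> rat.
  by rewrite lerBlDr lerDl exprn_ge0.
elim: K {ltK} => [|K IHK]; first by rewrite big_nil expr0 subrr.
by rewrite -addn1 iotaD big_cat /= big_seq1 add0n IHK addn1 exprS; field.
Qed.

End SemiPOVM.

Lemma recursive_in_subst (T : Type) (env env' : T -> seq nat) (B : countType)
    (f : T -> B) (qs : seq recf) :
  (forall x, revals qs (env x) (env' x)) -> recursive_in env' f ->
  recursive_in env f.
Proof. by move=> qsP [p pP]; exists (rComp p qs) => x; apply: ev_comp (pP x). Qed.

(** * Recursiveness of rational matrix operations *)

Section RecursiveMatrices.
Variables (T : Type) (env : T -> seq nat) (N : nat).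
Local Open Scope ring_scope.
Implicit Types A B H : T -> QCmat N.

Lemma recursive_in_Re_entry A i j :
  recursive_in env A -> recursive_in env (fun x => (A x).1 i j).
Proof. by move=> /recursive_in_fst; apply: recursive_in_entry. Qed.

Lemma recursive_in_Im_entry A i j :
  recursive_in env A -> recursive_in env (fun x => (A x).2 i j).
Proof. by move=> /recursive_in_snd; apply: recursive_in_entry. Qed.

Lemma recursive_in_QCmat A :
  (forall i j, recursive_in env (fun x => (A x).1 i j)) ->
  (forall i j, recursive_in env (fun x => (A x).2 i j)) ->
  recursive_in env A.
Proof.
move=> A1 A2; apply: (@eq_recursive_in _ _ _ (fun x => ((A x).1, (A x).2))).
  by move=> x; case: (A x).
by apply: recursive_in_pair; apply: recursive_in_mx.
Qed.

Lemma recursive_in_scalarQ (a : T -> rat) :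
  recursive_in env a -> recursive_in env (fun x => scalarQ N (a x)).
Proof.
move=> aR; apply: recursive_in_QCmat => i j /=.
  apply: (@eq_recursive_in _ _ _ (fun x => if i == j then a x else 0)) => [x|].
    by rewrite !mxE; case: eqP.
  by case: (i == j) => //; apply: recursive_in_const.
apply: (@eq_recursive_in _ _ _ (fun x => 0)); last exact: recursive_in_const.
by move=> x; rewrite mxE.
Qed.

Lemma recursive_in_subQC A B : recursive_in env A -> recursive_in env B ->
  recursive_in env (fun x => A x - B x).
Proof.
move=> AR BR; apply: recursive_in_QCmat => i j.
- apply: (@eq_recursive_in _ _ _ (fun x => (A x).1 i j - (B x).1 i j)) => [x|].
    by rewrite !mxE.
  by apply: recursive_in_subq; apply: recursive_in_Re_entry.
- apply: (@eq_recursive_in _ _ _ (fun x => (A x).2 i j - (B x).2 i j)) => [x|].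
    by rewrite !mxE.
  by apply: recursive_in_subq; apply: recursive_in_Im_entry.
Qed.

Lemma recursive_in_gramQ B :
  recursive_in env B -> recursive_in env (fun x => gramQ (B x)).
Proof.
move=> BR; have B1 i j := recursive_in_Re_entry i j BR.
have B2 i j := recursive_in_Im_entry i j BR.
apply: recursive_in_QCmat => i j.
- apply: eq_recursive_in (recursive_in_sum (index_enum _) (fun k =>
    recursive_in_addq (recursive_in_mulq (B1 k i) (B1 k j))
                      (recursive_in_mulq (B2 k i) (B2 k j)))) => x.
  by rewrite mxE.
- apply: eq_recursive_in (recursive_in_sum (index_enum _) (fun k =>
    recursive_in_subq (recursive_in_mulq (B1 k i) (B2 k j))
                      (recursive_in_mulq (B2 k i) (B1 k j)))) => x.
  by rewrite mxE.
Qed.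

Lemma recursive_in_smallQ (eta a : T -> rat) :
  recursive_in env eta -> recursive_in env a ->
  recursive_in env (fun x => smallQ (eta x) (a x)).
Proof.
move=> etaR aR; apply: recursive_in_andb; apply: recursive_in_leq_rat => //.
exact: recursive_in_oppq.
Qed.

Lemma recursive_in_psd_certificate (eta : T -> rat) A H B :
  recursive_in env eta -> recursive_in env A -> recursive_in env H ->
  recursive_in env B ->
  recursive_in env (fun x => psd_certificate (eta x) (A x) (H x) (B x)).
Proof.
move=> etaR AR HR /recursive_in_gramQ GR.
apply: recursive_in_forall => i; apply: recursive_in_forall => j.
apply: recursive_in_andb; apply: recursive_in_smallQ => //.
- apply: recursive_in_subq (recursive_in_Re_entry _ _ GR).
  by apply: recursive_in_subq; apply: recursive_in_Re_entry.
- apply: recursive_in_subq (recursive_in_Im_entry _ _ GR).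
  by apply: recursive_in_subq; apply: recursive_in_Im_entry.
Qed.

End RecursiveMatrices.

(** * Coding the candidates of the search *)

Section Witnesses.
Local Open Scope ring_scope.
Variable N : nat.
Let index := (bool * ('I_N * 'I_N))%type.

(* Every natural number decodes to a stage and a matrix, so that the unbounded
   search below never meets an invalid code. *)
Definition witness_rat (c : nat) : rat :=
  mkrat (nth 0 (CodeSeq.decode c) 0) (nth 0 (CodeSeq.decode c) 1)
        (nth 0 (CodeSeq.decode c) 2).+1.

(** Slot 0 of the decoded list holds the stage, so entries start at slot 1. The Boolean in the index
    selects the real or the imaginary part. *)
Definition witness_entry (k : nat) (e : index) : rat :=
  witness_rat (nth 0 (CodeSeq.decode k) (enum_rank e).+1).

Definition witness_mx (k : nat) : QCmat N :=
  (\matrix_(i, j) witness_entry k (true, (i, j)),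
   \matrix_(i, j) witness_entry k (false, (i, j))).

Definition witness_stage (k : nat) : nat := nth 0 (CodeSeq.decode k) 0.

(** The predecessor undoes the successor by which [witness_rat] keeps denominators positive. *)
Definition rat_witness (q : rat) : nat := CodeSeq.code
  [:: posz_part (numq q); negz_part (numq q); (posz_part (denq q)).-1].

Lemma rat_witnessK : cancel rat_witness witness_rat.
Proof.
move=> q; rewrite /witness_rat CodeSeq.codeK /= prednK ?posz_part_denq_gt0 //.
by rewrite -mkrat_parts.
Qed.

Lemma witness_surj (m : nat) (B : QCmat N) :
  exists2 k, witness_stage k = m & witness_mx k = B.
Proof.
pose B' (e : index) := (if e.1 then B.1 else B.2) e.2.1 e.2.2.
pose k := CodeSeq.code (m :: [seq rat_witness (B' e) | e <- enum (index : finType)]).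
have entryE e : witness_entry k e = B' e.
  rewrite /witness_entry CodeSeq.codeK /= (nth_map e) -?cardE //.
  by rewrite -(enum_val_nth e) enum_rankK rat_witnessK.
exists k; first by rewrite /witness_stage CodeSeq.codeK.
by rewrite [RHS]surjective_pairing; congr (_, _); apply/matrixP => i j;
  rewrite mxE entryE.
Qed.

Variables (T : Type) (env : T -> seq nat) (f : T -> nat).

Lemma recursive_in_witness_stage :
  recursive_in env f -> recursive_in env (fun x => witness_stage (f x)).
Proof. exact: recursive_in_nth. Qed.

Lemma recursive_in_witness_mx :
  recursive_in env f -> recursive_in env (fun x => witness_mx (f x)).
Proof.
move=> fR; have entryR e : recursive_in env (fun x => witness_entry (f x) e).
  apply: recursive_in_mkrat => //.
  - exact/recursive_in_nth/recursive_in_nth.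
  - exact/recursive_in_nth/recursive_in_nth.
  - exact/recursive_in_succ/recursive_in_nth/recursive_in_nth.
apply: recursive_in_QCmat => i j.
- by apply: eq_recursive_in (entryR (true, (i, j))) => x; rewrite mxE.
- by apply: eq_recursive_in (entryR (false, (i, j))) => x; rewrite mxE.
Qed.

End Witnesses.

(** * The increasing approximation *)

Section MonotoneApproximation.
Variable R : realType.
Local Notation C := (R[i]).
Local Notation toC := (real_complex R).
Local Open Scope ring_scope.
Variable N : nat.

Lemma loewner_embQ_scalar (a b : rat) : a <= b ->
  loewner (embQ R (scalarQ N a)) (embQ R (scalarQ N b)).
Proof.
move=> ab; rewrite /loewner !embQ_scalar -raddfB -rmorphB; apply: psd_scalar.
by rewrite ler0c subr_ge0 ler_rat.
Qed.

(** The family against which universality is tested; being rational already, it is its own constant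
    approximation. *)
Lemma lower_computable_inv2 :
  lower_computable (fun s : bstring => embQ R (scalarQ N (2^-1 ^+ (pickle s).+1))).
Proof.
split.
  split=> [s|l l_uniq].
    by rewrite embQ_scalar; apply: psd_scalar; rewrite ler0c ler0q exprn_ge0.
  have -> : \sum_(s <- l) embQ R (scalarQ N (2^-1 ^+ (pickle s).+1)) =
      embQ R (scalarQ N (\sum_(s <- l) 2^-1 ^+ (pickle s).+1)).
    rewrite embQ_scalar !rmorph_sum.
    by apply: eq_bigr => s _; rewrite embQ_scalar.
  have -> : 1%:M = embQ R (scalarQ N 1) by rewrite embQ_scalar !rmorph1.
  exact/loewner_embQ_scalar/sum_inv2_le1.
exists (fun u => scalarQ N (2^-1 ^+ (pickle u.2).+1)); split; last split; last split.
- apply: recursive_in_scalarQ; apply: recursive_in_inv2; apply: recursive_in_succ.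
  apply: recursive_in_comp (total_recursive_pickle _) _.
  exact: recursive_in_snd (total_recursive_id _).
- move=> n s; rewrite /in_HerQ embQ_scalar; apply: hermitian_scalar.
  by apply/ger0_real; rewrite ler0c ler0q exprn_ge0.
- move=> s eps eps_gt0; exists 0%N => n _; rewrite subrr.
  apply: le_trans (opnorm_le (lexx 0) _) _; last by rewrite !mulr0 ltW.
  by move=> i j; rewrite mxE normr0.
- by move=> n s; rewrite /loewner subrr; apply: psd0.
Qed.

Variables (M : bstring -> 'M[C]_N) (f : nat * bstring -> QCmat N) (c : nat).
Hypothesis M_semi : semiPOVM M.
Hypothesis f_rec : total_recursive f.
Hypothesis f_her : forall n s, in_HerQ R (f (n, s)).
Hypothesis f_cvg : forall s, forall eps : R, 0 < eps -> exists n0 : nat,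
  forall n : nat, (n0 <= n)%N -> opnorm (embQ R (f (n, s)) - M s) <= eps.
Hypothesis f_le : forall n s, loewner (embQ R (f (n, s))) (M s).

Definition inv2 (n : nat) : rat := 2^-1 ^+ n.
(** The exponent of the scalar floor [g s = 2^-c * 2^-(pickle s + 1)], where [2^-c] will lie below
    the constant of universality. *)
Definition floor_exp (s : bstring) : nat := c + (pickle s).+1.
Hypothesis M_ge : forall s, loewner (embQ R (scalarQ N (inv2 (floor_exp s)))) (M s).

(** The extra [N.+1] absorbs the factor [2 * N] lost in [psd_certificate_sound]. *)
Definition tolerance (n : nat) (s : bstring) : rat :=
  inv2 (floor_exp s + n.+2 + N.+1).

(** Requiring the stage to exceed [n] drives the stages to infinity, which convergence needs. *)
Definition improves (n : nat) (s : bstring) (H : QCmat N) (k : nat) : bool :=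
  (n < witness_stage k)%N &&
  psd_certificate (tolerance n s) (f (witness_stage k, s)) H (witness_mx N k).

(** The default 0 makes this total in [H]; it is never reached at [H = approx n s], the only case
    for which recursiveness is shown. *)
Definition first_witness (n : nat) (s : bstring) (H : QCmat N) : nat :=
  if pselect (exists k, improves n s H k) is left ex then ex_minn ex else 0.

Fixpoint approx (n : nat) (s : bstring) : QCmat N :=
  if n is n'.+1
  then f (witness_stage (first_witness n' s (approx n' s)), s)
  else scalarQ N (inv2 (floor_exp s)).

(** The sum of all errors still to come: step [m] may lose [g 2^-(m+2)], and these add up to
    [g 2^-(n+1)] over [m >= n]. *)
Definition slack (n : nat) (s : bstring) : rat := inv2 (floor_exp s + n.+1).

Definition approx_povm (u : nat * bstring) : QCmat N :=
  approx u.1 u.2 - scalarQ N (slack u.1 u.2).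

Lemma inv2_gt0 n : 0 < inv2 n.
Proof. by rewrite exprn_gt0. Qed.

Lemma inv2S n : inv2 n = inv2 n.+1 + inv2 n.+1.
Proof. by rewrite /inv2 exprS; field. Qed.

Lemma her_scalarQ a : in_HerQ R (scalarQ N a).
Proof.
rewrite /in_HerQ embQ_scalar; apply: hermitian_scalar.
by apply/complex_realP; exists (ratr a).
Qed.

Lemma improves_ex n s H : loewner (embQ R H) (M s) -> exists k, improves n s H k.
Proof.
move=> /(psd_certificate_complete (inv2_gt0 (floor_exp s + n.+2 + N.+1))).
move=> [B [eps eps_gt0 cert]]; have [n0 cvg] := f_cvg s eps_gt0.
(* The stage is late enough for the certificate to hold and also larger than [n]. *)
have [k kE BE] := witness_surj (maxn n0 n.+1) B.
by exists k; rewrite /improves kE BE leq_maxr /=; apply/cert/cvg/leq_maxl.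
Qed.

Lemma approx_le n s : loewner (embQ R (approx n s)) (M s).
Proof. by case: n => [|n]; [exact: M_ge | exact: f_le]. Qed.

Lemma approx_her n s : in_HerQ R (approx n s).
Proof. by case: n => [|n]; [exact: her_scalarQ | exact: f_her]. Qed.

Lemma first_witnessP n s (k := first_witness n s (approx n s)) :
  improves n s (approx n s) k /\
  forall k', improves n s (approx n s) k' -> (k <= k')%N.
Proof.
rewrite /k /first_witness; case: pselect => [ex|[]]; last exact/improves_ex/approx_le.
by case: ex_minnP.
Qed.

Lemma approx_step n s :
  psd (embQ R (approx n.+1 s) - embQ R (approx n s)
       + embQ R (scalarQ N (inv2 (floor_exp s + n.+2)))).
Proof.
have [/andP[_ cert] _] := first_witnessP n s.
have := psd_certificate_sound (ltW (inv2_gt0 _)) (f_her _ _) (approx_her _ _) cert.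
set eta := N%:R * _ => step.
have le_eta : eta <= inv2 (floor_exp s + n.+2).
  rewrite /eta /inv2 (exprD _ (floor_exp s + n.+2) N.+1); set a := _ ^+ (_ + n.+2).
  (* The second factor equals [N / 2^N], which is at most 1. *)
  rewrite (_ : N%:R * _ = a * (N%:R * (2 * 2^-1 ^+ N.+1))); last by ring.
  rewrite ler_piMr ?exprn_ge0 //.
  rewrite exprS [2 * _]mulrA divff // mul1r exprVn ler_pdivrMr ?exprn_gt0 // mul1r.
  by rewrite -natrX ler_nat ltnW // ltn_expl.
have := psdD step (loewner_embQ_scalar le_eta).
by rewrite !embQ_scalar addrACA subrr addr0.
Qed.

Lemma approx_povmE n s : embQ R (approx_povm (n, s)) =
  embQ R (approx n s) - embQ R (scalarQ N (slack n s)).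
Proof. exact: embQB. Qed.

Lemma approx_povm_her n s : in_HerQ R (approx_povm (n, s)).
Proof.
rewrite /in_HerQ approx_povmE; apply: hermitianB; first exact: approx_her.
exact: her_scalarQ.
Qed.

(** The drop in slack from [n] to [n.+1] is exactly the error allowed in [approx_step]. *)
Lemma approx_povm_mono n s :
  loewner (embQ R (approx_povm (n, s))) (embQ R (approx_povm (n.+1, s))).
Proof.
have := approx_step n s; rewrite /loewner !approx_povmE; congr psd.
have -> : embQ R (scalarQ N (slack n s)) =
    embQ R (scalarQ N (slack n.+1 s)) + embQ R (scalarQ N (inv2 (floor_exp s + n.+2))).
  by rewrite !embQ_scalar -raddfD -rmorphD /= -rmorphD /slack [in LHS]inv2S !addnS.
set H' := embQ R (approx n.+1 s); set H := embQ R (approx n s).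
set D := embQ R (scalarQ N (slack _ s)).
by rewrite opprB -[D + D - H]addrA [RHS]addrA subrK addrA addrAC.
Qed.

Lemma approx_povm_le n s : loewner (embQ R (approx_povm (n, s))) (M s).
Proof.
have slack_psd : psd (embQ R (scalarQ N (slack n s))).
  by rewrite embQ_scalar; apply: psd_scalar; rewrite ler0c ler0q ltW ?inv2_gt0.
by have := psdD (approx_le n s) slack_psd; rewrite /loewner approx_povmE opprB addrA addrAC.
Qed.

(** At stage 0 the matrix is the floor minus half of itself, a positive scalar; monotonicity carries
    this upwards. *)
Lemma approx_povm_posdef n s : posdef (embQ R (approx_povm (n, s))).
Proof.
elim: n => [|n IHn]; last first.
  by have := posdef_add_psd IHn (approx_povm_mono n s); rewrite addrC subrK.
rewrite approx_povmE !embQ_scalar -raddfB -rmorphB -rmorphB; apply: posdef_scalar.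
by rewrite (ltcR 0) ltr0q /slack [inv2 (floor_exp s)]inv2S addn1 addrK inv2_gt0.
Qed.

Lemma approx_povm_semi n : semiPOVM (fun s => embQ R (approx_povm (n, s))).
Proof.
split=> [s|l l_uniq]; first exact/posdef_psd/approx_povm_posdef.
have [_ /(_ l l_uniq)] := M_semi; apply: loewner_trans.
by apply: loewner_sum => s; apply: approx_povm_le.
Qed.

Lemma inv2_small (x : R) : 0 < x ->
  exists k, forall n, (k <= n)%N -> ratr (inv2 n) <= x.
Proof.
move=> x_gt0; exists (Num.bound x^-1) => n /upper_nthrootP/ltW le_n.
rewrite /inv2 exprVn fmorphV rmorphXn /= ratr_nat.
by rewrite -[x]invrK lef_pV2 ?posrE ?exprn_gt0 ?invr_gt0.
Qed.

Lemma approx_povm_cvg s (b : R) : 0 < b -> exists n0, forall n, (n0 <= n)%N ->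
  forall i j, `|(embQ R (approx_povm (n, s)) - M s) i j| <= toC b.
Proof.
move=> b_gt0; have b2_gt0 : 0 < b / 2 by rewrite divr_gt0.
have [k slack_le] := inv2_small b2_gt0; have [m0 cvg] := f_cvg s b2_gt0.
(* The successor excludes stage 0, where [approx] is the floor and not a value of [f]. At [n.+1] it
   is [f] at a stage beyond [n], hence beyond [m0]. *)
exists (maxn k m0).+1 => -[//|n]; rewrite ltnS geq_max => /andP[kn mn] i j.
rewrite approx_povmE addrAC mxE; apply: le_trans (ler_normD _ _) _.
rewrite [b]splitr rmorphD; apply: lerD.
  apply: le_trans (entry_le_opnorm _ _ _) _; rewrite lecR; apply: cvg.
  have [/andP[lt_n _] _] := first_witnessP n s.
  exact: leq_trans mn (ltnW lt_n).
rewrite embQ_scalar mxE normrN mxE normrMn ger0_norm; last first.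
  by rewrite ler0c ler0q ltW ?inv2_gt0.
apply: (@le_trans _ _ (toC (ratr (slack n.+1 s)))).
  by case: (i == j); rewrite ?mulr1n // mulr0n ler0c ler0q ltW ?inv2_gt0.
rewrite lecR; apply: slack_le; apply: leq_trans kn _.
by rewrite /slack !addnS; apply/leqW/leqW/leq_addl.
Qed.

Lemma approx_povm_cvg_seq (l : seq bstring) (b : R) : 0 < b ->
  exists n0, forall n, (n0 <= n)%N -> forall s, s \in l ->
  forall i j, `|(embQ R (approx_povm (n, s)) - M s) i j| <= toC b.
Proof.
move=> b_gt0; elim: l => [|s l [n1 cvg1]]; first by exists 0%N.
have [n2 cvg2] := approx_povm_cvg s b_gt0.
exists (maxn n1 n2) => n; rewrite geq_max => /andP[le1 le2] t.
by rewrite inE => /predU1P[->|t_in]; [apply: cvg2 | apply: cvg1].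
Qed.

(* Outside a finite set of strings M itself is small, hence so is M - F_n. *)
Lemma approx_povm_unif (eps : R) : 0 < eps -> exists n0 : nat, forall n : nat,
  (n0 <= n)%N -> forall s, opnorm (embQ R (approx_povm (n, s)) - M s) <= eps.
Proof.
(* Entries bounded by [b] give operator norm at most [N * N * b], which is at most [eps]; the added
   1 keeps the denominator positive. *)
move=> eps_gt0; pose b := eps / (N%:R * N%:R + 1).
have NN_gt0 : 0 < N%:R * N%:R + 1 :> R by rewrite ltr_wpDl // mulr_ge0.
have b_gt0 : 0 < b by rewrite divr_gt0.
have [l l_small] := semiPOVM_trace_small M_semi b_gt0.
have [n0 cvg] := approx_povm_cvg_seq l b_gt0; exists n0 => n le_n s.
apply: le_trans (opnorm_le (ltW b_gt0) _) _; last first.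
  by rewrite mulrA /b mulrA ler_pdivrMr // mulrC ler_pM2l // lerDl.
move=> i j; case: (boolP (s \in l)) => [/cvg|/l_small M_small]; first exact.
rewrite -opprB mxE normrN.
apply: le_trans (psd_entry_le_trace _ _ (approx_povm_le n s)) _.
apply: le_trans M_small; rewrite linearB /= gerBl; apply: psd_trace_ge0.
exact/posdef_psd/approx_povm_posdef.
Qed.

(** * Recursiveness of the approximation *)

Lemma recursive_in_floor_exp (T : Type) (env : T -> seq nat) (g : T -> bstring) :
  recursive_in env g -> recursive_in env (fun x => floor_exp (g x)).
Proof.
move=> gR; apply: recursive_in_add; first exact: recursive_in_nat.
exact/recursive_in_succ/(recursive_in_comp (total_recursive_pickle _) gR).
Qed.

Lemma total_recursive_improves : total_recursive
  (fun u : (nat * bstring * QCmat N) * nat => improves u.1.1.1 u.1.1.2 u.1.2 u.2).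
Proof.
have idR := total_recursive_id (nat * bstring * QCmat N * nat)%type.
have kR := recursive_in_snd idR; have uR := recursive_in_fst idR.
have HR := recursive_in_snd uR; have nsR := recursive_in_fst uR.
have nR := recursive_in_fst nsR; have sR := recursive_in_snd nsR.
have mR := recursive_in_witness_stage kR.
apply: recursive_in_andb; first exact: recursive_in_leq (recursive_in_succ nR) mR.
apply: recursive_in_psd_certificate => //.
- apply: recursive_in_inv2; apply: recursive_in_add (recursive_in_nat _ _).
  apply: recursive_in_add; first exact: recursive_in_floor_exp.
  exact/recursive_in_succ/recursive_in_succ.
- exact: recursive_in_comp f_rec (recursive_in_pair mR sR).
- exact: recursive_in_witness_mx.
Qed.

Lemma recursive_in_approx : recursive_in
  (fun u : nat * bstring => [:: u.1; pickle u.2]) (fun u => approx u.1 u.2).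
Proof.
apply: recursive_in_prec => /=.
  apply/recursive_in_scalarQ/recursive_in_inv2/recursive_in_floor_exp.
  exact: total_recursive_id.
set env := fun u : nat * bstring => _.
have nR : recursive_in env fst by apply: (@recursive_in_proj _ _ 0).
have HR : recursive_in env (fun u => approx u.1 u.2).
  exact: (@recursive_in_proj _ env 1).
have sR : recursive_in env snd by apply: (@recursive_in_proj _ env 2).
have kR : recursive_in env (fun u => first_witness u.1 u.2 (approx u.1 u.2)).
  (* [q] packs the index, the string and the previous matrix into the one code on which the search
     runs; a witness exists because this matrix is [approx n s]. *)
  have [q qP] := recursive_in_pair (recursive_in_pair nR sR) HR.
  apply: (@recursive_in_subst _ _ _ _ _ [:: q]) => [u|].
    exact: evs_cons (qP u) (evs_nil _).
  apply: recursive_in_search_pair total_recursive_improves _ _ => -[n s] /=.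
    by have [] := first_witnessP n s.
  by have [_] := first_witnessP n s.
apply: recursive_in_comp f_rec _; apply: recursive_in_pair sR.
exact: recursive_in_witness_stage.
Qed.

Lemma total_recursive_approx_povm : total_recursive approx_povm.
Proof.
have idR := total_recursive_id (nat * bstring)%type.
have nR := recursive_in_fst idR; have sR := recursive_in_snd idR.
apply: recursive_in_subQC.
  have [[p pP] [q qP]] := (nR, sR).
  apply: recursive_in_subst recursive_in_approx => u.
  exact: evs_cons (pP u) (evs_cons (qP u) (evs_nil _)).
apply/recursive_in_scalarQ/recursive_in_inv2.
by apply: recursive_in_add; [exact: recursive_in_floor_exp | exact: recursive_in_succ].
Qed.

End MonotoneApproximation.

(** * Assembling the sequence from universality *)

Local Open Scope ring_scope.

Theorem mainTheorem10 (R : realType) (N : nat) (HN : (0 < N)%N)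
    (M : bstring -> 'M[R[i]]_N) :
  universal_semiPOVM M ->
  exists F : nat * bstring -> QCmat N,
    (forall n, semiPOVM (fun s => embQ R (F (n, s)))) /\
    (forall n s,
        in_HerQ R (F (n, s)) /\
        posdef (embQ R (F (n, s))) /\
        loewner (embQ R (F (n, s))) (embQ R (F (n.+1, s))) /\
        loewner (embQ R (F (n.+1, s))) (M s)) /\
    (forall eps : R, 0 < eps -> exists n0 : nat, forall n : nat, (n0 <= n)%N ->
        forall s, opnorm (embQ R (F (n, s)) - M s) <= eps) /\
    total_recursive F.
Proof.
move=> [[M_semi [f [f_rec [f_her [f_cvg f_le]]]]] M_univ].
have [c [c_gt0 M_ge]] := M_univ _ (lower_computable_inv2 R N).
(* Replacing the real constant [c] by [2^-k] makes the floor rational and recursive in [s]. *)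
have [k /(_ k (leqnn k)) k_le] := inv2_small c_gt0.
have M_ge' s : loewner (embQ R (scalarQ N (inv2 (floor_exp k s)))) (M s).
  apply: loewner_trans (M_ge s); rewrite /loewner !embQ_scalar scale_scalar_mx.
  rewrite -raddfB -rmorphM -rmorphB; apply: psd_scalar; rewrite ler0c subr_ge0.
  rewrite /inv2 exprD rmorphM ler_wpM2r // ler0q exprn_ge0 //.
exists (approx_povm f k); split; last split; last split.
- exact: approx_povm_semi M_semi f_her f_cvg f_le M_ge'.
- move=> n s; split; last split; last split.
  + exact: approx_povm_her.
  + exact: approx_povm_posdef f_her f_cvg f_le M_ge' n s.
  + exact: approx_povm_mono f_her f_cvg f_le M_ge' n s.
  + exact: approx_povm_le.
- exact: approx_povm_unif M_semi f_her f_cvg f_le M_ge'.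
- exact: total_recursive_approx_povm f_rec f_cvg f_le M_ge'.
Qed.
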